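(* Let $(M,g(t))$, $t\in[0,T)$, be a solution to the Ricci flow $\frac{\partial}{\partial t}g_{ij}=-2R_{ij}$ on a closed surface (dimension $2$) with $R>0$. If $f$ is a positive solution on $M\times[0,T)$ to the nonlinear heat equation $$\frac{\partial}{\partial t}f=\Delta f-f\ln f+Rf ,$$ then for all $t\in(0,T)$, $$\frac{\partial}{\partial t}\ln f-|\nabla\ln f|^2+\ln f+\frac1t=\Delta\ln f+R+\frac1t\ge 0 .$$
   Context: A closed surface is a compact 2-dimensional manifold without boundary. At each time $t$, $R_{ij}$, $R$, $\Delta$, $\nabla$ and $|\cdot|$ denote the Ricci curvature, the scalar curvature, the Laplace–Beltrami operator, the gradient and the norm of the metric $g(t)$. Solutions are smooth. *)

(* Defs.v *)
From HB Require Import structures.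
From mathcomp Require Import all_boot all_order all_algebra.
From mathcomp Require Import all_classical all_reals all_analysis.

Set Implicit Arguments.
Unset Strict Implicit.
Unset Printing Implicit Defensive.

Import Order.TTheory GRing.Theory Num.Theory.
Import numFieldNormedType.Exports.

Local Open Scope classical_set_scope.
Local Open Scope ring_scope.

(** ** Smooth functions on possibly non-open domains

    Space-time domains have the form [[0, T[ x V] with [V] open, so derivatives
    are taken relative to the domain: two-sided at interior points, one-sided in
    time at [t = 0]. On an open domain [derive_within] agrees with [derive]. *)

Section Smooth.
Context {R : realType} {V W : normedModType R}.
Implicit Types (D : set V) (u : V -> W) (x v : V).

Definition diffquot_within D u x v : set_system W :=
  (h^-1 *: (u (x + h *: v) - u x))
    @[h --> within [set h : R | D (x + h *: v)] (0 : R)^'].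

Definition derivable_within D u x v : Prop := cvg (diffquot_within D u x v).

Definition derive_within D u x v : W := lim (diffquot_within D u x v).

Fixpoint Ck (k : nat) D u : Prop :=
  match k with
  | 0%N => {within D, continuous u}
  | m.+1 => {within D, continuous u} /\
      forall v, (forall x, D x -> derivable_within D u x v) /\
                Ck m D (fun x => derive_within D u x v)
  end.

Definition smooth_on D u : Prop := forall k, Ck k D u.

End Smooth.

(** Time derivative for [t >= 0]; a right derivative at [t = 0] and the usual
    derivative for [t > 0]. *)
Definition ddt {R : realType} (u : R -> R) (t : R) : R :=
  derive_within [set s : R | 0 <= s] u t (1 : R).

(** [T] is an extended real, so that [T = +oo] is allowed. *)
Definition timespan {R : realType} (T : \bar R) : set R :=
  [set t | 0 <= t /\ (t%:E < T)%E].

(** ** Smooth surfaces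

    The atlas need not be maximal. Outside [dom i] (resp. [cod i]) the values of
    [chart i] (resp. [ichart i]) are irrelevant. *)

Record surface_atlas (R : realType) (M : topologicalType) := SurfaceAtlas {
  idx : Type;
  dom : idx -> set M;
  chart : idx -> M -> 'rV[R]_2;
  ichart : idx -> 'rV[R]_2 -> M;
  dom_open : forall i, open (dom i);
  cod_open : forall i, open (chart i @` dom i);
  chartK : forall i p, dom i p -> ichart i (chart i p) = p;
  chart_continuous : forall i, {within dom i, continuous (chart i)};
  ichart_continuous :
    forall i, {within chart i @` dom i, continuous (ichart i)};
  dom_cover : forall p, exists i, dom i p;
  transition_smooth : forall i j,
    smooth_on (chart i @` (dom i `&` dom j)) (fun x => chart j (ichart i x))
}.

Definition cod {R : realType} {M : topologicalType} (A : surface_atlas R M)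
  (i : idx A) : set 'rV[R]_2 := chart i @` dom i.

(** Second countability is not required separately: it follows from compactness
    and the existence of charts. *)
Definition closed_surface (M : topologicalType) : Prop :=
  compact [set: M] /\ hausdorff_space M.

(** ** Riemannian geometry in local coordinates

    [g x] is the matrix of components [g_ij] at the point with coordinates
    [x]. *)

Section LocalGeometry.
Context {R : realType}.
Local Notation E := 'rV[R]_2.
Implicit Types (g : E -> 'M[R]_2) (u : E -> R) (x X : E) (a b c d : 'I_2).

Definition partial a u x : R := 'D_(delta_mx 0 a : E) u x.

Definition ginv g x : 'M[R]_2 := invmx (g x).

(** [christoffel g c a b] is Gamma^c_{ab}. *)
Definition christoffel g c a b x : R :=
  2^-1 * \sum_d ginv g x c d *
    (partial a (fun y => g y b d) x + partial b (fun y => g y a d) x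
     - partial d (fun y => g y a b) x).

Definition ricci g a b x : R :=
  \sum_c (partial c (christoffel g c a b) x
          - partial a (christoffel g c c b) x
          + \sum_d (christoffel g c c d x * christoffel g d a b x
                    - christoffel g c a d x * christoffel g d c b x)).

Definition scalar_curvature g x : R :=
  \sum_a \sum_b ginv g x a b * ricci g a b x.

Definition hessian g u a b x : R :=
  partial a (partial b u) x - \sum_c christoffel g c a b x * partial c u x.

Definition laplacian g u x : R :=
  \sum_a \sum_b ginv g x a b * hessian g u a b x.

Definition gradient g u x : E :=
  \row_a \sum_b ginv g x a b * partial b u x.

Definition metric_norm g x X : R :=
  Num.sqrt (\sum_a \sum_b g x a b * X 0 a * X 0 b).

End LocalGeometry.

(** ** Metrics and the Ricci flow on a surface *)

Section Flow.
Context {R : realType} {M : topologicalType} (A : surface_atlas R M).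
Local Notation E := 'rV[R]_2.

(** The components of a (0,2)-tensor field in each chart of the atlas. *)
Definition components := idx A -> E -> 'M[R]_2.

Definition riemannian_metric (g : components) : Prop :=
  [/\ forall i x, cod i x -> (g i x)^T = g i x,
      forall i x, cod i x -> forall v : E, v != 0 ->
        0 < (v *m g i x *m v^T) 0 0,
      forall i j x, (chart i @` (dom i `&` dom j)) x ->
        let tau y := chart j (ichart i y) in
        forall a b, g i x a b =
          \sum_c \sum_d partial a (fun y => tau y 0 c) x
                      * partial b (fun y => tau y 0 d) x
                      * g j (tau x) c d
    & forall i a b, smooth_on (cod i) (fun x => g i x a b)].

Definition ricci_flow (T : \bar R) (g : R -> components) : Prop :=
  [/\ forall t, timespan T t -> riemannian_metric (g t),
      forall i a b, smooth_on (timespan T `*` cod i)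
        (fun z : R * E => g z.1 i z.2 a b)
    & forall t, timespan T t -> forall i x, cod i x -> forall a b,
        ddt (fun s => g s i x a b) t = - 2 * ricci (g t i) a b x].

(** Coordinate expression of a function on the surface. *)
Definition in_chart (i : idx A) (u : M -> R) : E -> R := fun x => u (ichart i x).

Definition smooth_evolution (T : \bar R) (f : R -> M -> R) : Prop :=
  forall i, smooth_on (timespan T `*` cod i)
    (fun z : R * E => in_chart i (f z.1) z.2).

End Flow.

(* Main.v *)
Require Import Defs.
From HB Require Import structures.
From mathcomp Require Import all_boot all_order all_algebra.
From mathcomp Require Import all_classical all_reals all_analysis.
From mathcomp Require Import ring lra.

Set Implicit Arguments.
Unset Strict Implicit.
Unset Printing Implicit Defensive.

Import Order.TTheory GRing.Theory Num.Theory.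
Import numFieldNormedType.Exports.

Local Open Scope classical_set_scope.
Local Open Scope ring_scope.

(** In dimension two [Ric = (R/2) g], so the metric evolves by [dg/dt = - R g]
    and [dR/dt = Lap R + R^2].  Let [u] solve
    [du/dt = Lap u + |grad u|^2 - k u + R], which holds for [u = ln f] with
    [k = 1] and for [u = ln R] with [k = 0].  Bochner's formula yields, for
    [Q = Lap u + R],
    [dQ/dt = Lap Q + 2 <grad u, grad Q> + 2 |Hess u|^2 - 2 <grad u, grad R>
             + R |grad u|^2 - k Lap u + R Lap u + Lap R + R^2].
    Fix [s > 0] and put [F = (t - s) Q + 1], which equals [1] at [t = s].  At a
    space-time minimum where [F < 0], the bound [2 |Hess u|^2 >= (Lap u)^2] makes
    [dF/dt] positive: directly when [u = ln R] (Hamilton's trace estimate), and,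
    when [u = ln f], from Hamilton's estimate and
    [R |grad u|^2 - 2 <grad u, grad R> + Lap R
     = R |grad (u - ln R)|^2 + R Lap ln R].
    Since a minimum has [dF/dt <= 0], this forces [F >= 0]; then let [s] tend to
    [0].  The shift by [s] keeps the whole argument at positive times.

    [Q] is a function on the surface because [Q = du/dt - |grad u|^2 + k u], and
    [R] is one because [- R g] is the time derivative of a tensor; hence no
    second-order change of coordinates is ever computed. *)

(** * The Harnack quantity in a commutative differential ring *)

(** The constant in 1/t comes from the comparison equation q' = q^2, whose solution -1/(t - s)
    starts from minus infinity at time s; dimension two enters through the coefficient 1 in 2 |Hess
    u|^2 >= (Lap u)^2. Both estimates are compared with this solution for the same s, which is what
    lets Hamilton's estimate absorb the curvature terms in the one for ln f.

    The computations take place in an arbitrary commutative ring with commuting derivations: after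
    expansion by the Leibniz rule every tensor identity is a polynomial identity, settled by [ring]
    up to the relations for the inverse determinant and for [half]. The ring is later that of smooth
    functions on positive times times a chart domain. Analysis is left with the symmetry of second
    derivatives, the derivative tests at a minimum, and the chain rule for a change of chart;
    continuous directional derivatives suffice for all three. *)

Lemma big_ord2 (V : nmodType) (F : 'I_2 -> V) : \sum_(i < 2) F i = F 0 + F 1.
Proof.
rewrite !big_ord_recl big_ord0 addr0; congr (F _ + F _); exact: val_inj.
Qed.

Lemma ord2_ind (P : 'I_2 -> Prop) : P 0 -> P 1 -> forall i, P i.
Proof.
move=> P0 P1 [[|[|i]] hi] //.
- by rewrite (_ : Ordinal hi = 0) //; exact: val_inj.
- by rewrite (_ : Ordinal hi = 1) //; exact: val_inj.
Qed.

Section DifferentialAlgebra.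
Context (A : comPzRingType) (dx : 'I_2 -> A -> A) (dt : A -> A) (half : A).
Context (half2 : half + half = 1).
Context (dxD : forall i u v, dx i (u + v) = dx i u + dx i v).
Context (dxM : forall i u v, dx i (u * v) = dx i u * v + u * dx i v).
Context (dtD : forall u v, dt (u + v) = dt u + dt v).
Context (dtM : forall u v, dt (u * v) = dt u * v + u * dt v).
Context (dxC : forall i j u, dx i (dx j u) = dx j (dx i u)).
Context (dtC : forall i u, dt (dx i u) = dx i (dt u)).

Lemma dx0 i : dx i 0 = 0.
Proof. by apply: (addrI (dx i 0)); rewrite -dxD !addr0. Qed.
Lemma dxN i u : dx i (- u) = - dx i u.
Proof. by apply: (addrI (dx i u)); rewrite -dxD !subrr dx0. Qed.
Lemma dx1 i : dx i 1 = 0.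
Proof.
have := dxM i 1 1; rewrite !mulr1 mul1r => h.
by apply: (addrI (dx i 1)); rewrite -h addr0.
Qed.
Lemma dxh i : dx i half = 0.
Proof.
by rewrite -[LHS]mul1r -half2 mulrDl -mulrDr -dxD half2 dx1 mulr0.
Qed.
Lemma dt0 : dt 0 = 0.
Proof. by apply: (addrI (dt 0)); rewrite -dtD !addr0. Qed.
Lemma dtN u : dt (- u) = - dt u.
Proof. by apply: (addrI (dt u)); rewrite -dtD !subrr dt0. Qed.
Lemma dt1 : dt 1 = 0.
Proof.
have := dtM 1 1; rewrite !mulr1 mul1r => h.
by apply: (addrI (dt 1)); rewrite -h addr0.
Qed.
Lemma dth : dt half = 0.
Proof.
by rewrite -[LHS]mul1r -half2 mulrDl -mulrDr -dtD half2 dt1 mulr0.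
Qed.

Definition dE := (dxD, dxM, dxN, dx0, dx1, dxh, dtD, dtM, dtN, dt0, dt1, dth).

(* [dinv] is the inverse of the determinant of the metric [g]. *)
Context (g : 'I_2 -> 'I_2 -> A) (dinv : A).
Context (g10 : g 1 0 = g 0 1).
Context (det1 : dinv * (g 0 0 * g 1 1 - g 0 1 * g 0 1) = 1).

(* [gi], [Gam] and [Scal] are locked: rewriting with the Leibniz rule would
   otherwise see the products inside them. *)
Definition gi (a b : 'I_2) : A := locked (
  if a == 0 then (if b == 0 then dinv * g 1 1 else - (dinv * g 0 1))
  else (if b == 0 then - (dinv * g 0 1) else dinv * g 0 0)).

Definition Gam (c a b : 'I_2) : A := locked (
  half * \sum_d gi c d * (dx a (g b d) + dx b (g a d) - dx d (g a b))).

Definition Ric (a b : 'I_2) : A :=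
  \sum_c (dx c (Gam c a b) - dx a (Gam c c b)
          + \sum_d (Gam c c d * Gam d a b - Gam c a d * Gam d c b)).

Definition Scal : A := locked (\sum_a \sum_b gi a b * Ric a b).

Definition Hess (u : A) (a b : 'I_2) : A :=
  dx a (dx b u) - \sum_c Gam c a b * dx c u.

Definition Lap (u : A) : A := \sum_a \sum_b gi a b * Hess u a b.

Definition ip (u v : A) : A := \sum_a \sum_b gi a b * (dx a u * dx b v).

Definition hess2 (u : A) : A :=
  \sum_a \sum_b \sum_c \sum_d gi a c * gi b d * (Hess u a b * Hess u c d).

(** * Metric compatibility, curvature and Bochner's formula in dimension two *)

Lemma gi10 : gi 1 0 = gi 0 1. Proof. by rewrite /gi -!lock. Qed.

Lemma gig00 : gi 0 0 * g 0 0 + gi 0 1 * g 0 1 = 1.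
Proof. by rewrite /gi -!lock /= -[RHS]det1; ring. Qed.
Lemma gig01 : gi 0 0 * g 0 1 + gi 0 1 * g 1 1 = 0.
Proof. by rewrite /gi -!lock /=; ring. Qed.
Lemma gig10 : gi 0 1 * g 0 0 + gi 1 1 * g 0 1 = 0.
Proof. by rewrite /gi -!lock /=; ring. Qed.
Lemma gig11 : gi 0 1 * g 0 1 + gi 1 1 * g 1 1 = 1.
Proof. by rewrite /gi -!lock /= -[RHS]det1; ring. Qed.

Lemma Gam10 c : Gam c 1 0 = Gam c 0 1.
Proof. by rewrite /Gam -!lock !big_ord2 g10; ring. Qed.

(** The contraction with [g] cancels the [gi] inside [Gam] and leaves the Christoffel symbols of the
    first kind. *)
Lemma lower (c a b : 'I_2) :
  \sum_d g b d * Gam d c a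
  = half * (dx c (g a b) + dx a (g c b) - dx b (g c a)).
Proof.
rewrite big_ord2 /Gam -!lock !big_ord2 gi10.
move: gig00 gig01 gig10 gig11; generalize (gi 0 0) (gi 0 1) (gi 1 1) =>
  x y z e00 e01 e10 e11.
elim/ord2_ind: b; rewrite ?g10.
- set p := (_ + _ - _); set q := (_ + _ - _).
  transitivity (half * ((x * g 0 0 + y * g 0 1) * p + (y * g 0 0 + z * g 0 1) * q));
    first by ring.
  by rewrite e00 e10; ring.
- set p := (_ + _ - _); set q := (_ + _ - _).
  transitivity (half * ((x * g 0 1 + y * g 1 1) * p + (y * g 0 1 + z * g 1 1) * q));
    first by ring.
  by rewrite e01 e11; ring.
Qed.

(** Metric compatibility of the Levi-Civita connection: adding two symbols of the first kind cancels
    all derivatives but one, which is counted twice. *)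
Lemma dx_metric c a b :
  dx c (g a b) = \sum_d (g b d * Gam d c a + g a d * Gam d c b).
Proof.
rewrite big_split /= !lower.
have sg i j : g i j = g j i by elim/ord2_ind: i; elim/ord2_ind: j; rewrite ?g10.
rewrite (sg b a) -[LHS]mul1r -half2; ring.
Qed.

(** Stated for an arbitrary derivation, since it serves both [dx c] and [dt]. The derivative of
    [dinv] comes from differentiating [det1]; the rest is the cofactor formula for [gi]. *)
Lemma derivation_gi (D : A -> A) :
  (forall u v, D (u + v) = D u + D v) ->
  (forall u v, D (u * v) = D u * v + u * D v) -> 
  forall a b, D (gi a b) = - \sum_e \sum_f gi a e * D (g e f) * gi f b.
Proof.
move=> DD DM.
have D0 : D 0 = 0 by apply: (addrI (D 0)); rewrite -DD !addr0.
have DN u : D (- u) = - D u by apply: (addrI (D u)); rewrite -DD !subrr D0.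
have D1 : D 1 = 0.
  have := DM 1 1; rewrite !mulr1 mul1r => h.
  by apply: (addrI (D 1)); rewrite -h addr0.
pose det := g 0 0 * g 1 1 - g 0 1 * g 0 1.
have det1' : dinv * det = 1 := det1.
have dd : D dinv = - (dinv * dinv * D det).
  have := congr1 D det1; rewrite DM D1 => h.
  rewrite -[LHS]mulr1 -det1'.
  transitivity (dinv * (D dinv * det + dinv * D det) - dinv * dinv * D det);
    first by ring.
  by rewrite h; ring.
have Edet : D det = D (g 0 0) * g 1 1 + g 0 0 * D (g 1 1) - (D (g 0 1) * g 0 1 *+ 2).
  by rewrite /det DD DN !DM; ring.
elim/ord2_ind => //; elim/ord2_ind => //;
  rewrite !big_ord2 /gi -!lock /= ?DN DM dd Edet g10.
(* [ring] does not know [dinv * det = 1], so the difference of the two sides is exhibited as a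
   multiple of [1 - dinv * det]; the other three components go the same way. *)
- set l := LHS; set r := RHS.
  suff : l - r = dinv * D (g 1 1) * (1 - dinv * det) by rewrite det1' subrr mulr0 =>
    /subr0_eq.
  by rewrite /l /r /det; ring.
- set l := LHS; set r := RHS.
  suff : l - r = - dinv * D (g 0 1) * (1 - dinv * det) by rewrite det1' subrr mulr0 =>
    /subr0_eq.
  by rewrite /l /r /det; ring.
- set l := LHS; set r := RHS.
  suff : l - r = - dinv * D (g 0 1) * (1 - dinv * det) by rewrite det1' subrr mulr0 =>
    /subr0_eq.
  by rewrite /l /r /det; ring.
- set l := LHS; set r := RHS.
  suff : l - r = dinv * D (g 0 0) * (1 - dinv * det) by rewrite det1' subrr mulr0 =>
    /subr0_eq.
  by rewrite /l /r /det; ring.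
Qed.

Lemma gKr d b : g 0 d * gi 0 b + g 1 d * gi 1 b = (d == b)%:R.
Proof.
by elim/ord2_ind: d; elim/ord2_ind: b; rewrite /gi -!lock /= ?g10 -?det1; ring.
Qed.
Lemma gKl a d : gi a 0 * g 0 d + gi a 1 * g 1 d = (a == d)%:R.
Proof.
by elim/ord2_ind: d; elim/ord2_ind: a; rewrite /gi -!lock /= ?g10 -?det1; ring.
Qed.

Lemma dx_gi c a b :
  dx c (gi a b) = - \sum_d (gi a d * Gam b c d + gi b d * Gam a c d).
Proof.
rewrite (@derivation_gi (dx c)) //; congr (- _).
transitivity (\sum_e \sum_d (gi a e * Gam d c e * (g 0 d * gi 0 b + g 1 d * gi 1 b)
  + (gi a 0 * g 0 d + gi a 1 * g 1 d) * Gam d c e * gi e b)).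
  rewrite !big_ord2 !dx_metric !big_ord2 g10; ring.
under eq_bigr do under eq_bigr do rewrite gKl gKr.
rewrite !big_ord2; elim/ord2_ind: a; elim/ord2_ind: b; rewrite /= gi10; ring.
Qed.

(* The curvature components R^e_{b01}; in dimension two there are no others. *)
Definition Rm (e b : 'I_2) : A :=
  dx 0 (Gam e 1 b) - dx 1 (Gam e 0 b)
  + \sum_f (Gam e 0 f * Gam f 1 b - Gam e 1 f * Gam f 0 b).

Lemma Ric1 b : Ric 1 b = Rm 0 b.
Proof. by rewrite /Ric /Rm !big_ord2; ring. Qed.
Lemma Ric0 b : Ric 0 b = - Rm 1 b.
Proof. by rewrite /Ric /Rm !big_ord2; ring. Qed.

(** The second derivatives of [g a b] commute; expanding both orders by [dx_metric] gives the
    antisymmetry of the curvature tensor in its first two indices. *)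
Lemma Rm_antisym a b :
  \sum_e (Rm e a * g e b + Rm e b * g e a) = 0.
Proof.
have := dxC 0 1 (g a b).
rewrite !(dx_metric _ a b) !big_ord2 !dE !dx_metric !big_ord2 => /eqP;
  rewrite -subr_eq0 => /eqP <-.
rewrite /Rm !big_ord2; elim/ord2_ind: a; elim/ord2_ind: b;
  rewrite !g10 ?(Gam10 0) ?(Gam10 1); ring.
Qed.

(** Antisymmetry leaves one independent curvature component. The identities [e00], [e11], [e01]
    concern the tensor with its first index lowered; the inverse metric then raises it again. *)
Lemma Ric_Scal a b : Ric a b = half * Scal * g a b.
Proof.
(* [k] is the fully lowered component R_{0101}; [dinv * k] is the Gauss curvature, half of
   [Scal]. *)
pose k := Rm 0 1 * g 0 0 + Rm 1 1 * g 0 1.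
have dbl (x : A) : x + x = 0 -> x = 0.
  by move=> h; rewrite -[x]mul1r -half2 mulrDl -mulrDr h mulr0.
have e00 : Rm 0 0 * g 0 0 + Rm 1 0 * g 0 1 = 0.
  by apply: dbl; rewrite -(Rm_antisym 0 0) big_ord2 g10; ring.
have e11 : Rm 0 1 * g 0 1 + Rm 1 1 * g 1 1 = 0.
  by apply: dbl; rewrite -(Rm_antisym 1 1) big_ord2 ; ring.
have e01 : Rm 0 0 * g 0 1 + Rm 1 0 * g 1 1 = - k.
  apply/eqP; rewrite -addr_eq0 -(Rm_antisym 0 1) big_ord2 g10 /k; apply/eqP; ring.
have r01 : Rm 0 1 = dinv * g 1 1 * k.
  by rewrite -[LHS]mul1r -det1; apply: subr0_eq;
    rewrite -[RHS](mulr0 (- dinv * g 0 1)) -e11 /k; ring.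
have r11 : Rm 1 1 = - dinv * g 0 1 * k.
  by rewrite -[LHS]mul1r -det1; apply: subr0_eq;
    rewrite -[RHS](mulr0 (dinv * g 0 0)) -e11 /k; ring.
have k' : k = - (Rm 0 0 * g 0 1 + Rm 1 0 * g 1 1) by rewrite e01 opprK.
have r00 : Rm 0 0 = dinv * g 0 1 * k.
  by rewrite -[LHS]mul1r -det1; apply: subr0_eq;
    rewrite -[RHS](mulr0 (dinv * g 1 1)) -e00 k'; ring.
have r10 : Rm 1 0 = - dinv * g 0 0 * k.
  by rewrite -[LHS]mul1r -det1; apply: subr0_eq;
    rewrite -[RHS](mulr0 (- dinv * g 0 1)) -e00 k'; ring.
have RE c d : Ric c d = dinv * k * g c d.
  by elim/ord2_ind: c; elim/ord2_ind: d; rewrite ?Ric0 ?Ric1 ?r00 ?r01 ?r10 ?r11 ?g10;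
    ring.
have SE : Scal = (1 + 1) * (dinv * k).
  rewrite /Scal -lock !big_ord2 !RE /gi -!lock /= g10; set w := dinv * k; rewrite -det1;
    ring.
by rewrite RE SE [half * _]mulrA [half * _]mulrDr mulr1 half2 mul1r.
Qed.

Lemma HessC u a b : Hess u a b = Hess u b a.
Proof.
rewrite /Hess !big_ord2 dxC.
by elim/ord2_ind: a; elim/ord2_ind: b; rewrite ?Gam10.
Qed.

(** The connection annihilates [gi], so the Christoffel terms from [dx_gi] turn plain second
    derivatives into Hessians. *)
Lemma dx_ip c u v :
  dx c (ip u v) = \sum_a \sum_b gi a b * (Hess u c a * dx b v + Hess v c a * dx b u).
Proof.
rewrite /ip /Hess !big_ord2 !dE !dx_gi !big_ord2 gi10 ?(Gam10 0) ?(Gam10 1).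
have dxC' := dxC 1 0.
by elim/ord2_ind: c; rewrite ?(Gam10 0) ?(Gam10 1) ?dxC'; ring.
Qed.

(* Only the torsion-free connection and [nabla gi = 0] enter here, so this is a
   polynomial identity in [gi], [Gam], the derivatives of [Gam] and those of [u]. *)
Lemma bochner_Rm u :
  Lap (ip u u) = (1 + 1) * hess2 u + (1 + 1) * ip u (Lap u)
   - (1 + 1) * \sum_e \sum_d (gi 0 d * (\sum_b gi 1 b * dx b u)
                - gi 1 d * (\sum_b gi 0 b * dx b u)) * Rm e d * dx e u.
Proof.
rewrite /Lap /(Hess (ip _ _)) !big_ord2.
rewrite !dx_ip /hess2 /ip.
rewrite  !big_ord2 /Rm /Hess !big_ord2.
rewrite !(dxD, dxM, dxN).
rewrite !dx_gi.
rewrite !big_ord2.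
rewrite gi10 ?(Gam10 0) ?(Gam10 1).
rewrite !(dxC 1 0).
ring.
Qed.

(** The curvature term of [bochner_Rm] is twice the Ricci curvature of the gradient, which
    [Ric_Scal] reduces to [Scal * ip u u]. *)
Lemma bochner u :
  Lap (ip u u) = (1 + 1) * hess2 u + (1 + 1) * ip u (Lap u) + Scal * ip u u.
Proof.
rewrite bochner_Rm; congr (_ + _).
have R0 d : Rm 0 d = half * Scal * g 1 d by rewrite -Ric1 Ric_Scal.
have R1 d : Rm 1 d = - half * Scal * g 0 d.
  by rewrite -[LHS]opprK -Ric0 Ric_Scal !mulNr.
have g01 := gig01; have g10' := gig10; have e0 := gig00; have e1 := gig11.
transitivity ((half + half) * Scal *
  ((gi 0 0 * g 0 0 + gi 0 1 * g 0 1) * (gi 1 0 * dx 0 u + gi 1 1 * dx 1 u) * dx 1 u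
  + (gi 0 1 * g 0 1 + gi 1 1 * g 1 1) * (gi 0 0 * dx 0 u + gi 0 1 * dx 1 u) * dx 0 u 
  - (gi 0 0 * g 0 1 + gi 0 1 * g 1 1) * (gi 1 0 * dx 0 u + gi 1 1 * dx 1 u) * dx 0 u
  - (gi 0 1 * g 0 0 + gi 1 1 * g 0 1) * (gi 0 0 * dx 0 u + gi 0 1 * dx 1 u) * dx 1 u)).
  rewrite !big_ord2 !R0 !R1 g10 gi10; ring.
rewrite g01 g10' e0 e1 half2 /ip !big_ord2 gi10; ring.
Qed.

(** * Evolution of the geometry under the flow *)

Context (flow : forall a b, dt (g a b) = - (1 + 1) * Ric a b).

Lemma dt_metric a b : dt (g a b) = - (Scal * g a b).
Proof.
rewrite flow Ric_Scal mulNr; congr (- _).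
by rewrite !mulrA mulrDl !mul1r half2 mul1r.
Qed.

Lemma dt_gi a b : dt (gi a b) = Scal * gi a b.
Proof.
rewrite (@derivation_gi dt) //.
transitivity (Scal * \sum_e gi a e * (g 0 e * gi 0 b + g 1 e * gi 1 b)).
  rewrite !big_ord2 !dt_metric g10; ring.
under eq_bigr do rewrite gKr.
by rewrite !big_ord2; elim/ord2_ind: b; rewrite /=; ring.
Qed.

(** Variation of the connection under a conformal change of metric: the terms where [Scal] is not
    differentiated cancel between [dt_gi] and [dt_metric]. *)
Lemma dt_Gam c a b :
  dt (Gam c a b) = - half * ((c == b)%:R * dx a Scal + (c == a)%:R * dx b Scal
     - g a b * \sum_d gi c d * dx d Scal).
Proof.
have -> : dt (Gam c a b) = - half *
  \sum_d gi c d * (dx a Scal * g b d + dx b Scal * g a d - dx d Scal * g a b).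
  rewrite /Gam -!lock !big_ord2 !dE !dt_gi !dtC !dt_metric !dE; ring.
rewrite -!gKl !big_ord2; elim/ord2_ind: a; elim/ord2_ind: b; rewrite ?g10; ring.
Qed.

(** The product of [half] and [1 + 1] is left as it stands, so that in [dt_Ric] every term carries
    one factor [half] and [ring] closes the goal. *)
Lemma dt_trGam b : \sum_c dt (Gam c c b) = - half * ((1 + 1) * dx b Scal).
Proof.
rewrite big_ord2 !dt_Gam !big_ord2.
transitivity (- half * ((1 + 1) * dx b Scal
  + (((0 == b)%:R * dx 0 Scal + (1 == b)%:R * dx 1 Scal)
  - ((gi 0 0 * g 0 b + gi 0 1 * g 1 b) * dx 0 Scal + (gi 1 0 * g 0 b + gi 1 1 * g 1 b)
    * dx 1 Scal)))).
  by rewrite gi10 /=; ring.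
by rewrite !gKl subrr addr0.
Qed.

(** The variation of [Ric] is the divergence of [dt Gam] minus the derivative of its trace; by
    [dt_Gam] the Hessians of [Scal] cancel and only a multiple of the metric survives. *)
Lemma dt_Ric a b : dt (Ric a b) = half * g a b * Lap Scal.
Proof.
have -> : dt (Ric a b) =
  \sum_c dx c (dt (Gam c a b)) - dx a (- half * ((1 + 1) * dx b Scal)) +
  \sum_d (- half * ((1 + 1) * dx d Scal) * Gam d a b + (\sum_c Gam c c d)
    * dt (Gam d a b))
  - \sum_c \sum_d (dt (Gam c a d) * Gam d c b + Gam c a d * dt (Gam d c b)).
  by rewrite !big_ord2 -!dt_trGam /Ric !big_ord2 !dE !dtC; ring.
rewrite !big_ord2 !dt_Gam /Lap /Hess !big_ord2 !dE !dx_gi !dx_metric !big_ord2 gi10.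
elim/ord2_ind: a; elim/ord2_ind: b;
  rewrite /= ?g10 !dE ?(Gam10 0) ?(Gam10 1) ?(dxC 1 0); ring.
Qed.

Lemma dt_Scal : dt Scal = Lap Scal + Scal * Scal.
Proof.
rewrite {1}/Scal -lock !big_ord2 !dE !dt_gi !dt_Ric.
transitivity (Lap Scal * (half * ((gi 0 0 * g 0 0 + gi 0 1 * g 0 1)
  + (gi 0 1 * g 0 1 + gi 1 1 * g 1 1))) + Scal * (\sum_a \sum_b gi a b * Ric a b)).
  rewrite !big_ord2 g10 gi10; ring.
rewrite gig00 gig11 mulrDr mulr1 half2 mulr1; congr (_ + _ * _).
by rewrite [RHS]/Scal -lock.
Qed.

(** The possible extra term is the contraction [v] of [dt Gam] with [gi], a multiple of 2 minus the
    dimension. Its vanishing is the conformal covariance of the Laplacian on a surface. *)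
Lemma dt_Lap u : dt (Lap u) = Lap (dt u) + Scal * Lap u.
Proof.
pose v c := \sum_a \sum_b gi a b * dt (Gam c a b).
have -> : dt (Lap u) = Lap (dt u) + Scal * Lap u - \sum_c v c * dx c u.
  by rewrite /v /Lap /Hess !big_ord2 !dE !dt_gi !dtC; ring.
suff v0 c : v c = 0 by rewrite big1 ?subr0 // => c _; rewrite v0 mul0r.
transitivity (- half * ((gi 0 c * dx 0 Scal + gi 1 c * dx 1 Scal) * ((1 + 1)
    - (gi 0 0 * g 0 0 + gi 0 1 * g 0 1) - (gi 0 1 * g 0 1 + gi 1 1 * g 1 1)))).
  rewrite /v !big_ord2 !dt_Gam !big_ord2 g10.
  by elim/ord2_ind: c; rewrite /= gi10; ring.
by rewrite gig00 gig11; ring.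
Qed.

Lemma dt_Harnack u k : dt k = 0 -> (forall c, dx c k = 0) ->
  dt u = Lap u + ip u u - k * u + Scal ->
  dt (Lap u + Scal) = Lap (Lap u + Scal) + (1 + 1) * hess2 u
    + (1 + 1) * ip u (Lap u + Scal) - (1 + 1) * ip u Scal + Scal * ip u u
    - k * Lap u + Scal * Lap u + Lap Scal + Scal * Scal.
Proof.
move=> tk xk ut.
have LapD v w : Lap (v + w) = Lap v + Lap w.
  by rewrite /Lap /Hess !big_ord2 !dE; ring.
have LapN v : Lap (- v) = - Lap v by rewrite /Lap /Hess !big_ord2 !dE; ring.
have LapM v : Lap (k * v) = k * Lap v.
  by rewrite /Lap /Hess !big_ord2 !(dE, xk); ring.
have ipD v : ip u (Lap v + Scal) = ip u (Lap v) + ip u Scal.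
  by rewrite /ip !big_ord2 !dE; ring.
by rewrite dtD dt_Lap dt_Scal ut !(LapD, LapN, LapM) bochner ipD; ring.
Qed.

(** The hypothesis stands for u = ln f, so that no logarithm has to exist in the abstract ring. *)
Lemma Lap_log f u : (forall c, dx c f = f * dx c u) ->
  Lap f = f * (Lap u + ip u u).
Proof.
move=> fu; rewrite /Lap /Hess /ip !big_ord2 !fu !(dE, fu); ring.
Qed.

(** [M] is the Hessian with one index raised, so [hess2 u] is tr M^2 and [Lap u] is tr M, and 2 tr
    M^2 - (tr M)^2 = (M00 - M11)^2 + 4 M01 M10. Self-adjointness of M expresses [gi 0 0] M10 through
    M01 and M00 - M11; multiplying by the square of [gi 0 0] and completing the square gives this
    form. *)
Lemma hess2_Lap u :
  gi 0 0 * gi 0 0 * ((1 + 1) * hess2 u - Lap u * Lap u) =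
  let M a b := gi a 0 * Hess u 0 b + gi a 1 * Hess u 1 b in
  (gi 0 0 * (M 0 0 - M 1 1) + (1 + 1) * gi 0 1 * M 0 1) ^+ 2
  + (1 + 1) * (1 + 1) * (gi 0 0 * gi 1 1 - gi 0 1 * gi 0 1) * M 0 1 ^+ 2.
Proof.
rewrite /hess2 /Lap !big_ord2 (HessC u 1 0) /= gi10; ring.
Qed.

(* [ev] is evaluation at a point. *)
Context (K : realFieldType) (ev : A -> K).
Context (evD : forall u v, ev (u + v) = ev u + ev v).
Context (evM : forall u v, ev (u * v) = ev u * ev v).
Context (ev1 : ev 1 = 1).
Context (gi_gt0 : 0 < ev (gi 0 0)).
Context (det_gi_gt0 : 0 < ev (gi 0 0) * ev (gi 1 1) - ev (gi 0 1) * ev (gi 0 1)).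

(** * Pointwise inequalities at a minimum *)

Lemma ev0 : ev 0 = 0.
Proof. by apply: (addrI (ev 0)); rewrite -evD !addr0. Qed.
Lemma evN u : ev (- u) = - ev u.
Proof. by apply: (addrI (ev u)); rewrite -evD !subrr ev0. Qed.

Definition evE := (evD, evN, evM, ev0, ev1).

Lemma ev_ip u v : ev (ip u v) =
  ev (gi 0 0) * ev (dx 0 u) * ev (dx 0 v)
  + ev (gi 0 1) * (ev (dx 0 u) * ev (dx 1 v) + ev (dx 1 u) * ev (dx 0 v))
  + ev (gi 1 1) * ev (dx 1 u) * ev (dx 1 v).
Proof. by rewrite /ip !big_ord2 !evE gi10; ring. Qed.

Lemma ev_ip_ge0 u : 0 <= ev (ip u u).
Proof.
rewrite -(pmulr_rge0 _ gi_gt0) ev_ip.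
move: gi_gt0 det_gi_gt0; generalize (ev (gi 0 0)) (ev (gi 0 1)) (ev (gi 1 1))
  (ev (dx 0 u)) (ev (dx 1 u)).
move=> a b c p q a0 d0.
rewrite [X in 0 <= X](_ : _ = (a * p + b * q) ^+ 2 + (a * c - b * b) * q ^+ 2);
  last by ring.
by rewrite addr_ge0 ?sqr_ge0 // mulr_ge0 ?sqr_ge0 // ltW.
Qed.

Lemma ev_hess2_ge u : ev (Lap u) ^+ 2 <= 2 * ev (hess2 u).
Proof.
have := congr1 ev (hess2_Lap u).
rewrite /= !(evE, expr2) => e.
rewrite -subr_ge0 -(pmulr_rge0 _ (mulr_gt0 gi_gt0 gi_gt0)).
rewrite (_ : 2 = 1 + 1) // e -!expr2.
have d : 0 <= (1 + 1) * (1 + 1) * (ev (gi 0 0) * ev (gi 1 1) - ev (gi 0 1) * ev (gi 0 1)).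
  by apply: mulr_ge0; [lra | exact: ltW].
by apply: addr_ge0; [exact: sqr_ge0 | apply: mulr_ge0 => //; exact: sqr_ge0].
Qed.

(** As quadratic forms, [gi 0 0] times the inverse metric is the square of its first row plus its
    determinant times the square of coordinate 1. So two second derivatives suffice: along
    coordinate 1 and along the vector ([gi 0 0], [gi 0 1]), the latter expanded in the hypothesis.
    The Christoffel terms vanish at a critical point. *)
Lemma ev_Lap_ge0 q : ev (dx 0 q) = 0 -> ev (dx 1 q) = 0 ->
  0 <= ev (dx 1 (dx 1 q)) ->
  0 <= ev (gi 0 0) ^+ 2 * ev (dx 0 (dx 0 q))
    + 2 * ev (gi 0 0) * ev (gi 0 1) * ev (dx 0 (dx 1 q))
    + ev (gi 0 1) ^+ 2 * ev (dx 1 (dx 1 q)) ->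
  0 <= ev (Lap q).
Proof.
move=> q0 q1 q11 qv.
rewrite -(pmulr_rge0 _ gi_gt0) /Lap /Hess !big_ord2 !evE q0 q1 gi10 (dxC 1 0).
move: gi_gt0 det_gi_gt0 q11 qv.
generalize (ev (gi 0 0)) (ev (gi 0 1)) (ev (gi 1 1)) (ev (dx 0 (dx 0 q)))
  (ev (dx 0 (dx 1 q))) (ev (dx 1 (dx 1 q))).
move=> a b c x y z a0 d0 z0 qv.
rewrite [X in 0 <= X](_ : _ = (a ^+ 2 * x + 2 * a * b * y + b ^+ 2 * z)
  + (a * c - b * b) * z); last by ring.
by rewrite addr_ge0 // mulr_ge0 // ltW.
Qed.

Lemma ev_dt_harnack u k : dt k = 0 -> (forall c, dx c k = 0) ->
  dt u = Lap u + ip u u - k * u + Scal ->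
  let Q := Lap u + Scal in
  ev (dx 0 Q) = 0 -> ev (dx 1 Q) = 0 -> 0 <= ev (Lap Q) ->
  ev (Lap u) ^+ 2 - 2 * ev (ip u Scal) + ev Scal * ev (ip u u) - ev k * ev (Lap u)
    + ev Scal * ev (Lap u) + ev (Lap Scal) + ev Scal ^+ 2 <= ev (dt Q).
Proof.
move=> tk xk ut Q q0 q1 qL.
have := dt_Harnack tk xk ut.
rewrite -/Q => ->; rewrite !evE.
have -> : ev (ip u Q) = 0 by rewrite ev_ip q0 q1; ring.
by have := ev_hess2_ge u; move: qL; lra.
Qed.

(** For l = ln R the lower bound of [ev_dt_harnack] is exactly the square of [Q], and Q + tau Q^2 =
    Q (1 + tau Q) is a product of two negative numbers. The conclusion is about the time derivative
    of tau Q + 1, with [tau] the elapsed time. *)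
Lemma hamilton_reaction l tau : 0 < tau -> 0 < ev Scal ->
  (forall c, dx c Scal = Scal * dx c l) ->
  dt l = Lap l + ip l l + Scal ->
  let Q := Lap l + Scal in
  ev (dx 0 Q) = 0 -> ev (dx 1 Q) = 0 -> 0 <= ev (Lap Q) ->
  tau * ev Q + 1 < 0 -> 0 < ev Q + tau * ev (dt Q).
Proof.
move=> t0 R0 Rl lt Q q0 q1 qL Qneg.
have lt' : dt l = Lap l + ip l l - 0 * l + Scal by rewrite mul0r subr0.
have := ev_dt_harnack dt0 dx0 lt' q0 q1 qL; rewrite -/Q ev0.
have -> : ev (ip l Scal) = ev Scal * ev (ip l l).
  by rewrite !ev_ip !Rl !evM; ring.
rewrite (Lap_log Rl) evM evD => H.
have QE : ev Q = ev (Lap l) + ev Scal by rewrite evD.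
have H2 : ev Q ^+ 2 <= ev (dt Q) by rewrite QE; apply: le_trans H; rewrite le_eqVlt;
  apply/orP; left; apply/eqP; ring.
have Q0 : ev Q < 0 by rewrite -(pmulr_rlt0 _ t0); lra.
have : tau * ev Q ^+ 2 <= tau * ev (dt Q) by rewrite ler_pM2l.
have : 0 < ev Q * (1 + tau * ev Q) by rewrite nmulr_rgt0 //; lra.
rewrite expr2; lra.
Qed.

(** Write r, q, L for [Scal], [Q], [Lap l]. Once r |grad (u - l)|^2 is dropped, the lower bound is
    q^2 - r q - q + r + r^2 + r L, and the hypothesis on L gives r^2 + r L >= - r / tau. Multiplied
    by tau and increased by q, the bound becomes q (1 + tau q) + r (- tau q - 1) + tau (r - q),
    where no term is negative and the first is positive. *)
Lemma heat_reaction l u tau : 0 < tau -> 0 < ev Scal ->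
  (forall c, dx c Scal = Scal * dx c l) ->
  0 <= tau * ev (Lap l + Scal) + 1 ->
  dt u = Lap u + ip u u - u + Scal ->
  let Q := Lap u + Scal in
  ev (dx 0 Q) = 0 -> ev (dx 1 Q) = 0 -> 0 <= ev (Lap Q) ->
  tau * ev Q + 1 < 0 -> 0 < ev Q + tau * ev (dt Q).
Proof.
move=> t0 R0 Rl Lpos ut Q q0 q1 qL Qneg.
have ut' : dt u = Lap u + ip u u - 1 * u + Scal by rewrite mul1r.
have := ev_dt_harnack dt1 dx1 ut' q0 q1 qL; rewrite -/Q ev1.
have ipE : ev (ip u Scal) = ev Scal * ev (ip u l) by rewrite !ev_ip !Rl !evM; ring.
have sq := ev_ip_ge0 (u - l).
have sqE : ev (ip (u - l) (u - l)) = ev (ip u u) - 2 * ev (ip u l) + ev (ip l l).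
  by rewrite !ev_ip !dxD !dxN !evE; ring.
rewrite (Lap_log Rl) ipE evM evD => H.
have QE : ev (Lap u) = ev Q - ev Scal by rewrite evD addrK.
have LE : ev (Lap l + Scal) = ev (Lap l) + ev Scal by rewrite evD.
rewrite LE in Lpos.
move: sq H; rewrite sqE QE.
move: R0 Qneg Lpos; generalize (ev Scal) (ev Q) (ev (dt Q)) (ev (ip u u)) (ev (ip u l))
  (ev (ip l l)) (ev (Lap l)).
move=> r q dq uu ul ll L r0 qn Lp sq H.
have q0' : q < 0 by rewrite -(pmulr_rlt0 _ t0); lra.
have a1 : 0 <= r * (uu - 2 * ul + ll) by rewrite mulr_ge0 // ltW.
have H' : (q - r) ^+ 2 - (q - r) + r * (q - r) + r * L + r ^+ 2 <= dq by lra.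
have a2 : tau * ((q - r) ^+ 2 - (q - r) + r * (q - r) + r * L + r ^+ 2) <= tau * dq
  by rewrite ler_pM2l.
have a3 : 0 <= r * (tau * (L + r) + 1) by rewrite mulr_ge0 // ltW.
have a4 : 0 < q * (1 + tau * q) by rewrite nmulr_rgt0 //; lra.
have a5 : 0 < tau * (r - q) by rewrite mulr_gt0 //; lra.
have a6 : 0 <= r * (- tau * q - 1) by rewrite mulr_ge0 ?(ltW r0) //; lra.
move: a2 a3 a4 a5 a6; rewrite !expr2; lra.
Qed.
End DifferentialAlgebra.

(** * Directional calculus *)

Section Calculus.
Context {R : realType} {V : normedModType R}.
Implicit Types (D : set V) (u : V -> R) (x y v w e : V).

Lemma is_derive_line u x e h :
  derivable u (x + h *: e) e ->
  is_derive h 1 (fun s : R => u (x + s *: e)) ('D_e u (x + h *: e)).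
Proof.
have E : (fun k : R => k^-1 *: (((fun s : R => u (x + s *: e)) \o shift h) (k *: 1)
  - u (x + h *: e)))
  = (fun k : R => k^-1 *: ((u \o shift (x + h *: e)) (k *: e) - u (x + h *: e))).
  apply/funext => k /=; congr (_ *: (u _ - _)).
  by rewrite [_%:A]mulr1 scalerDl addrCA.
by move=> du; split; rewrite /derivable /derive E.
Qed.

Lemma mvt_dir u x e (r : R) :
  (forall s : R, `|s| <= `|r| -> derivable u (x + s *: e) e) ->
  exists2 c : R, `|c| <= `|r| & u (x + r *: e) - u x = 'D_e u (x + c *: e) * r.
Proof.
move=> du; pose f := fun s : R => u (x + s *: e).
pose df := fun s : R => 'D_e u (x + s *: e) : R.
have isf (s : R) : `|s| <= `|r| -> is_derive s (1 : R) f (df s).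
  by move=> /du; exact: is_derive_line.
have cf (a b : R) : (forall s, s \in `[a, b] -> `|s| <= `|r|)
  -> {within `[a, b], continuous f}.
  move=> H; apply: derivable_within_continuous => s sab.
  by have [] := isf s (H s sab).
have f0 : u x = f 0 by rewrite /f scale0r addr0.
rewrite f0 -/(f r).
have [r0|r0] := leP 0 r.
- have Hs s : s \in `[0, r] -> `|s| <= `|r|.
    by rewrite in_itv /= => /andP[s0 sr]; rewrite !ger0_norm.
  have Ho s : s \in `]0, r[ -> `|s| <= `|r|.
    by move=> /subset_itv_oo_cc /Hs.
  have [c cr ->] := MVT_segment r0 (fun s hs => isf s (Ho s hs)) (cf _ _ Hs).
  by exists c; [exact: Hs | rewrite subr0].
- have Hs s : s \in `[r, 0] -> `|s| <= `|r|.
    rewrite in_itv /= => /andP[s0 sr]; rewrite !ler0_norm ?(ltW r0) //; lra.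
  have Ho s : s \in `]r, 0[ -> `|s| <= `|r|.
    by move=> /subset_itv_oo_cc /Hs.
  have [c cr E] := MVT_segment (ltW r0) (fun s hs => isf s (Ho s hs)) (cf _ _ Hs).
  by exists c; [exact: Hs | rewrite -opprB E sub0r mulrN opprK].
Qed.

(** The base point [x + p] may move, thanks to the mean value theorem and continuity of the
    derivative at [x]. Thus a displacement along one vector can be followed by another that starts
    where the first ended. *)
Lemma strict_derive D u x e (eps : R) : open D -> D x ->
  (forall y, D y -> derivable u y e) -> {for x, continuous ('D_e u)} -> 0 < eps ->
  exists2 d : R, 0 < d & forall (p : V) (r : R), `|p| < d -> `|r| < d ->
    `|u (x + p + r *: e) - u (x + p) - r * 'D_e u x| <= eps * `|r|.
Proof.
move=> oD Dx du cu e0.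
have : \forall y \near x, D y /\ `|'D_e u x - 'D_e u y| <= eps.
  near=> y; split; first by near: y; exact: open_nbhs_nbhs.
  by near: y; move/cvgrPdist_le : cu; apply.
move=> /nbhs_normP[d /= d0 Hd].
have e1 : 0 < 1 + `|e| by rewrite ltr_pwDl.
(* With this radius |p| + |r| |e| < d, so the segment stays in the ball where the derivative is
   controlled. *)
exists (d / (1 + `|e|)); first by rewrite divr_gt0.
move=> p r pd rd.
have H s : `|s| <= `|r| -> D (x + p + s *: e) /\ `|'D_e u x - 'D_e u (x + p + s *: e)|
  <= eps.
  move=> sr; apply: Hd => /=; rewrite /ball_ /= -addrA opprD addrA subrr sub0r normrN.
  apply: le_lt_trans (ler_normD _ _) _; rewrite normrZ.
  have sd := le_lt_trans sr rd.
  have : `|p| + `|s| * `|e| < d / (1 + `|e|) + d / (1 + `|e|) * `|e|.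
    by apply: ltr_leD => //; apply: ler_wpM2r => //; exact: ltW.
  by rewrite (_ : d / (1 + `|e|) + _ = d) //; field; rewrite gt_eqF.
have [s sr|c cr ->] := @mvt_dir u (x + p) e r.
  by apply: du; have [] := H s sr.
have [_ Hc] := H c cr.
rewrite mulrC -mulrBr normrM mulrC distrC; exact: ler_wpM2r.
Unshelve. all: by end_near. Qed.

(** The coefficients may be nonlinear in [h]: linear ones give linearity of directional derivatives,
    those of a transition map the change of charts. Continuity at [x] of the two directional
    derivatives takes the place of Frechet differentiability. *)
Lemma is_derive0_chain D u x v w (al be : R -> R) (a b : R) :
  open D -> D x ->
  (forall y, D y -> derivable u y v) -> {for x, continuous ('D_v u)} ->
  (forall y, D y -> derivable u y w) -> {for x, continuous ('D_w u)} ->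
  al 0 = 0 -> be 0 = 0 -> is_derive (0 : R) (1 : R) al a
    -> is_derive (0 : R) (1 : R) be b ->
  is_derive (0 : R) (1 : R) (fun h : R => u (x + al h *: v + be h *: w))
    (a * 'D_v u x + b * 'D_w u x).
Proof.
move=> oD Dx dv cv dw cw al0 be0 da db.
(* [g] is the remainder after the linear part; it splits into a step along [v] from [x] and a step
   along [w] from [x + al h *: v], each controlled by [strict_derive]. *)
pose g h := u (x + al h *: v + be h *: w) - u x - al h * 'D_v u x - be h * 'D_w u x.
have g0 : g 0 = 0 by rewrite /g al0 be0 !scale0r !addr0 !mul0r subrr !subr0.
have small (c : R -> R) (l : R) : c 0 = 0 -> is_derive (0 : R) (1 : R) c l ->
    \forall h \near (0 : R)^', `|c h| <= (`|l| + 1) * `|h|.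
  move=> c0 [dc lc].
  have : (h^-1 *: (c h - c 0)) @[h --> 0^'] --> l.
    move: dc; rewrite /derivable => /cvg_ex[l' hl'].
    have l'l : l' = l by rewrite -lc; apply/esym/cvg_lim.
    move: hl'; rewrite l'l; apply: cvg_trans; apply: near_eq_cvg; near=> h.
    by rewrite /= addr0 [_%:A]mulr1.
  move=> /cvgr_dist_le/(_ _ ltr01); apply: filterS2 (nbhs_dnbhs_neq 0) => h hn0.
  rewrite c0 subr0 => Hl.
  have : `|h^-1 *: c h| <= `|l| + 1.
    rewrite -[X in `|X|](subrK l) (le_trans (ler_normD _ _)) // addrC lerD //.
    by rewrite distrC.
  by rewrite normrZ normfV ler_pdivrMl ?normr_gt0 // mulrC.
have to0 (c : R -> R) (l d : R) : 0 < d -> c 0 = 0 -> is_derive (0 : R) (1 : R) c l ->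
    \forall h \near (0 : R)^', `|c h| < d.
  move=> d0 c0 dc; have l0 : 0 < `|l| + 1 by rewrite ltr_wpDl.
  near=> h; apply: (@le_lt_trans _ _ ((`|l| + 1) * `|h|)); first by near: h; exact: small.
  by rewrite mulrC -ltr_pdivlMr //; near: h; apply: dnbhs0_lt; rewrite divr_gt0.
have dg : is_derive (0 : R) (1 : R) g 0.
  have H : (h^-1 *: (g h - g 0)) @[h --> 0^'] --> (0 : R).
    rewrite g0; apply/cvgrPdist_le => eps eps0.
    pose C := `|a| + 1 + (`|b| + 1).
    have C0 : 0 < C by rewrite /C addr_gt0 // ltr_wpDl.
    have [d1 d10 H1] := strict_derive oD Dx dv cv (divr_gt0 eps0 C0).
    have [d2 d20 H2] := strict_derive oD Dx dw cw (divr_gt0 eps0 C0).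
    have v0 : 0 < d2 / (1 + `|v|) by rewrite divr_gt0 // ltr_pwDl.
    near=> h.
    have hn0 : h != 0 by near: h; exact: nbhs_dnbhs_neq.
    rewrite subr0 sub0r normrN normrZ normfV ler_pdivrMl ?normr_gt0 //.
    have K1 := H1 0 (al h). have K2 := H2 (al h *: v) (be h).
    rewrite /g (_ : _ - _ = (u (x + 0 + al h *: v) - u (x + 0) - al h * 'D_v u x)
      + (u (x + al h *: v + be h *: w) - u (x + al h *: v) - be h * 'D_w u x));
        last first.
      by rewrite addr0; ring.
    apply: le_trans (ler_normD _ _) _.
    apply: le_trans (lerD (K1 _ _) (K2 _ _)) _.
    - by rewrite normr0.
    - by near: h; exact: (to0 _ a).
    - rewrite normrZ; apply: (@le_lt_trans _ _ (`|al h| * (1 + `|v|))).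
        by apply: ler_wpM2l => //; rewrite lerDr.
      rewrite -ltr_pdivlMr ?ltr_pwDl //.
      by near: h; exact: (to0 _ a).
    - by near: h; exact: (to0 _ b).
    have A1 : `|al h| <= (`|a| + 1) * `|h| by near: h; exact: small.
    have A2 : `|be h| <= (`|b| + 1) * `|h| by near: h; exact: small.
    rewrite -mulrDr.
    apply: (@le_trans _ _ (eps / C * (C * `|h|))).
      by apply: ler_wpM2l; [rewrite ltW // divr_gt0 | rewrite /C mulrDl lerD].
    by rewrite mulrA divfK ?gt_eqF // mulrC.
  have E : (fun k : R => k^-1 *: ((g \o shift 0) (k *: 1) - g 0))
    = (fun h => h^-1 *: (g h - g 0)).
    by apply/funext => k /=; rewrite addr0 [_%:A]mulr1.
  split; rewrite /derivable /derive E; first by apply/cvg_ex; exists 0.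
  exact/cvg_lim.
have -> : (fun h : R => u (x + al h *: v + be h *: w)) =
   g + (cst (u x) + ('D_v u x *: al + 'D_w u x *: be)).
  apply/funext => h; rewrite /g !fctE.
  by rewrite ![_ *: _ : R]mulrC; ring.
have H := is_deriveD dg (is_deriveD (is_derive_cst (u x) (0 : R) (1 : R))
  (is_deriveD (is_deriveZ ('D_v u x) da) (is_deriveZ ('D_w u x) db))).
rewrite (_ : a * _ + _ = 0 + (0 + ('D_v u x *: a + 'D_w u x *: b))) //.
by rewrite !add0r ![_ *: _ : R]mulrC.
Unshelve. all: by end_near. Qed.

Lemma is_derive_linear D u x v w (a b : R) :
  open D -> D x ->
  (forall y, D y -> derivable u y v) -> {for x, continuous ('D_v u)} ->
  (forall y, D y -> derivable u y w) -> {for x, continuous ('D_w u)} ->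
  is_derive x (a *: v + b *: w) u (a * 'D_v u x + b * 'D_w u x).
Proof.
move=> oD Dx dv cv dw cw.
have da (c : R) : is_derive (0 : R) (1 : R) (fun h : R => h * c) c.
  have -> : (fun h : R => h * c) = c *: id by apply/funext => h; rewrite mulrC.
  by apply: is_derive_eq; rewrite [_%:A]mulr1.
have [H1 H2] := @is_derive0_chain D u x v w (fun h => h * a) (fun h => h * b) a b
   oD Dx dv cv dw cw (mul0r _) (mul0r _) (da a) (da b).
have E : (fun h : R => h^-1 *: ((u \o shift x) (h *: (a *: v + b *: w)) - u x)) =
   (fun k : R => k^-1 *: (((fun h : R =>
     u (x + (h * a) *: v + (h * b) *: w)) \o shift 0) (k *: 1)
       - u (x + (0 * a) *: v + (0 * b) *: w))).
  apply/funext => h /=; rewrite !mul0r !scale0r !addr0 [_%:A]mulr1.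
  congr (_ *: (u _ - _)).
  by rewrite scalerDr !scalerA addrC addrA.
by split; rewrite /derivable /derive E.
Qed.

Lemma derive_shiftE u a y v : 'D_v (fun z => u (z + a)) y = 'D_v u (y + a).
Proof. by rewrite /derive /= ; under eq_fun do rewrite -addrA. Qed.
Lemma derivable_shiftE u a y v : derivable u (y + a) v
  -> derivable (fun z => u (z + a)) y v.
Proof. by rewrite /derivable /=; under [X in _ -> cvg (X @ _)]eq_fun do rewrite -addrA.
  Qed.

(** Two mean value theorems turn the second difference into a mixed derivative at an intermediate
    point. The difference is symmetric in [v] and [w], hence [schwarz]; with [w = - v] it yields the
    second derivative test. *)
Lemma second_difference D u x v w (eps : R) : open D -> D x -> 0 < eps ->
  (forall y, D y -> derivable u y v) -> 
  (forall y, D y -> derivable ('D_v u) y w) ->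
  {for x, continuous ('D_w ('D_v u))} ->
  exists2 d : R, 0 < d & forall h : R, 0 < h < d ->
   `|(u (x + h *: v + h *: w) - u (x + h *: v) - u (x + h *: w) + u x) / h ^+ 2
    - 'D_w ('D_v u) x| <= eps.
Proof.
move=> oD Dx e0 dv dwv c.
have : \forall y \near x, D y /\ `|'D_w ('D_v u) x - 'D_w ('D_v u) y| <= eps.
  near=> y; split; first by near: y; exact: open_nbhs_nbhs.
  by near: y; move/cvgrPdist_le : c; apply.
move=> /nbhs_normP[d /= d0 Hd].
have e1 : 0 < 1 + (`|v| + `|w|) by rewrite ltr_pwDl // addr_ge0.
exists (d / (1 + (`|v| + `|w|))); first by rewrite divr_gt0.
move=> h /andP[h0 hd].
have H (s r : R) : `|s| <= `|h| -> `|r| <= `|h| -> D (x + s *: v + r *: w) /\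
    `|'D_w ('D_v u) x - 'D_w ('D_v u) (x + s *: v + r *: w)| <= eps.
  move=> sh rh; apply: Hd => /=; rewrite /ball_ /= -addrA opprD addrA subrr sub0r normrN.
  apply: le_lt_trans (ler_normD _ _) _; rewrite !normrZ.
  rewrite ltr_pdivlMr // in hd.
  rewrite (gtr0_norm h0) in sh rh.
  apply: le_lt_trans hd; rewrite mulrDr mulr1 mulrDr ler_wpDl ?(ltW h0) //.
  by apply: lerD; apply: ler_wpM2r.
pose U y := u (y + h *: w) - u y.
have dU (s : R) : `|s| <= `|h| -> is_derive (x + s *: v) v U
  ('D_v u (x + s *: v + h *: w) - 'D_v u (x + s *: v)).
  move=> sh; rewrite -derive_shiftE.
  have A1 : derivable (fun z => u (z + h *: w)) (x + s *: v) v.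
    by apply: derivable_shiftE; apply: dv; have [] := H s h sh (lexx _).
  have A2 : derivable u (x + s *: v) v.
    apply: dv; have [] := H s 0 sh; first by rewrite normr0.
    by rewrite scale0r addr0.
  apply: is_deriveB; exact/derivableP.
have [s /dU[]//|s sh Es] := @mvt_dir U x v h.
have [_ Us] := dU s sh.
have [r rh|r rh Er] := @mvt_dir ('D_v u) (x + s *: v) w h.
  by apply: dwv; have [] := H s r sh rh.
have [_ Hsr] := H s r sh rh.
have -> : u (x + h *: v + h *: w) - u (x + h *: v) - u (x + h *: w) + u x
  = 'D_w ('D_v u) (x + s *: v + r *: w) * h * h.
  by rewrite -Er -Us -Es /U; ring.
have hn0 : h != 0 by rewrite gt_eqF.
set q := 'D_w ('D_v u) (x + s *: v + r *: w) in Hsr *.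
by rewrite (_ : q * h * h / h ^+ 2 = q) 1?distrC //; field.
Unshelve. all: by end_near. Qed.

Lemma schwarz D u x v w : open D -> D x ->
  (forall y, D y -> derivable u y v) -> 
  (forall y, D y -> derivable u y w) -> 
  (forall y, D y -> derivable ('D_v u) y w) ->
  (forall y, D y -> derivable ('D_w u) y v) ->
  {for x, continuous ('D_w ('D_v u))} ->
  {for x, continuous ('D_v ('D_w u))} ->
  'D_w ('D_v u) x = 'D_v ('D_w u) x.
Proof.
move=> oD Dx dv dw dwv dvw c1 c2; apply/eqP; rewrite -subr_eq0 -normr_le0.
apply/ler_addgt0Pl => eps eps0; rewrite addr0.
have e2 : 0 < eps / 2 by rewrite divr_gt0.
have [d1 d10 H1] := second_difference oD Dx e2 dv dwv c1.
have [d2 d20 H2] := second_difference oD Dx e2 dw dvw c2.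
pose h := Num.min d1 d2 / 2.
have m0 : 0 < Num.min d1 d2 by rewrite lt_min d10 d20.
have mh : h < Num.min d1 d2 by rewrite /h; lra.
move: (mh); rewrite lt_min => /andP[hd1 hd2].
have h0 : 0 < h by rewrite divr_gt0.
have := H1 h; rewrite h0 hd1 => /(_ isT) K1.
have := H2 h; rewrite h0 hd2 => /(_ isT).
rewrite (addrAC x) (_ : u (x + h *: v + h *: w) - u (x + h *: w) - u (x + h *: v) + u x =
 u (x + h *: v + h *: w) - u (x + h *: v) - u (x + h *: w) + u x); last by ring.
move: K1; set q := (X in X / _); set a := 'D_w _ x; set b := 'D_v _ x => K1 K2.
have -> : a - b = (q / h ^+ 2 - b) - (q / h ^+ 2 - a) by rewrite opprB [RHS]addrC subrKA.
rewrite (splitr eps); apply: le_trans (ler_normB _ _) _.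
exact: lerD K2 K1.
Qed.

End Calculus.

(** * Classes of differentiability on open sets *)

Section SmoothClass.
Context {R : realType} {V : normedModType R}.
Implicit Types (D : set V) (u : V -> R) (x y v w : V).

(** The counterpart of [Ck] with two-sided derivatives, to which the usual rules of calculus apply;
    [Ck_Cn] passes to it on open subsets. *)
Fixpoint Cn (n : nat) D u : Prop :=
  match n with
  | 0%N => forall x, D x -> {for x, continuous u}
  | m.+1 => (forall x, D x -> {for x, continuous u}) /\
      forall v, (forall x, D x -> derivable u x v) /\ Cn m D ('D_v u)
  end.

Lemma Cn_cont n D u : Cn n D u -> forall x, D x -> {for x, continuous u}.
Proof. by case: n => [|n] //= []. Qed.

Lemma CnW n D u : Cn n.+1 D u -> Cn n D u.
Proof.
elim: n u => [|n IH] u [cu H]; first by [].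
split=> // v; have [dv cv] := H v; split => //; exact: IH.
Qed.

Lemma near_open D x (P : V -> Prop) : open D -> D x -> (forall y, D y -> P y) ->
  \forall y \near x, P y.
Proof. by move=> oD Dx DP; apply: filterS DP _; exact: open_nbhs_nbhs. Qed.

Lemma Cn_ext n D (u v : V -> R) :
  open D -> (forall x, D x -> u x = v x) -> Cn n D u -> Cn n D v.
Proof.
move=> oD; elim: n u v => [|n IH] u v uv Cu.
  all: have E x : D x -> {near x, u =1 v} by move=> Dx; exact: near_open Dx _.
  all: have c0 : forall x, D x -> {for x, continuous v}.
  1,3: move=> x Dx; have := Cn_cont Cu Dx; rewrite /prop_for /continuous_at (uv x Dx).
  1,2: by apply: cvg_trans; apply: near_eq_cvg; exact: E.
- by [].
split=> // w; have [_ /(_ w)[dw cw]] := Cu; split.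
  by move=> x Dx; apply: (near_eq_derivable (E x Dx)); exact: dw.
by apply: IH cw => x Dx; exact: near_eq_derive (E x Dx).
Qed.

Lemma Cn_cst n D (c : R) : Cn n D (cst c).
Proof.
elim: n c => [|n IH] c /=; first by move=> x _; exact: cst_continuous.
split; first by move=> x _; exact: cst_continuous.
move=> v; split; first by move=> x _; exact: derivable_cst.
by rewrite (_ : 'D_v (cst c) = cst 0) //; apply/funext => x; rewrite derive_cst.
Qed.

Lemma CnD n D (u v : V -> R) : open D -> Cn n D u -> Cn n D v
  -> Cn n D (fun x => u x + v x).
Proof.
move=> oD; elim: n u v => [|n IH] u v.
  by move=> cu cv x Dx; apply: continuousD; [exact: cu|exact: cv].
move=> [cu Hu] [cv Hv]; split.
  by move=> x Dx; apply: continuousD; [exact: cu|exact: cv].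
move=> w; have [du Cu] := Hu w; have [dv Cv] := Hv w; split.
  by move=> x Dx; apply: derivableD; [exact: du|exact: dv].
apply: Cn_ext (IH _ _ Cu Cv) => // x Dx.
by rewrite -deriveD //; [exact: du|exact: dv].
Qed.

Lemma CnN n D u : open D -> Cn n D u -> Cn n D (fun x => - u x).
Proof.
move=> oD; elim: n u => [|n IH] u.
  by move=> cu x Dx; apply: continuousN; exact: cu.
move=> [cu Hu]; split.
  by move=> x Dx; apply: continuousN; exact: cu.
move=> w; have [du Cu] := Hu w; split.
  by move=> x Dx; apply: derivableN; exact: du.
apply: Cn_ext (IH _ Cu) => // x Dx.
by rewrite -deriveN //; exact: du.
Qed.

Lemma CnM n D (u v : V -> R) : open D -> Cn n D u -> Cn n D v
  -> Cn n D (fun x => u x * v x).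
Proof.
move=> oD; elim: n u v => [|n IH] u v.
  by move=> cu cv x Dx; apply: continuousM; [exact: cu|exact: cv].
move=> cu0 cv0; have [cu Hu] := cu0; have [cv Hv] := cv0; split.
  by move=> x Dx; apply: continuousM; [exact: cu|exact: cv].
move=> w; have [du Cu] := Hu w; have [dv Cv] := Hv w; split.
  by move=> x Dx; apply: derivableM; [exact: du|exact: dv].
apply: Cn_ext (CnD oD (IH _ _ (CnW cu0) Cv) (IH _ _ (CnW cv0) Cu)) => // x Dx.
by rewrite -deriveM //; [exact: du|exact: dv].
Qed.

Lemma CnV n D u : open D -> (forall x, D x -> u x != 0) -> Cn n D u
  -> Cn n D (fun x => (u x)^-1).
Proof.
move=> oD u0; elim: n => [|n IH].
  by move=> cu x Dx; apply: continuousV; [exact: u0|exact: cu].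
move=> cu0; have [cu Hu] := cu0; split.
  by move=> x Dx; apply: continuousV; [exact: u0|exact: cu].
move=> w; have [du Cu] := Hu w; split.
  by move=> x Dx; apply: derivableV; [exact: u0|exact: du].
have Iu := IH (CnW cu0).
apply: Cn_ext (CnN oD (CnM oD (CnM oD Iu Iu) Cu)) => // x Dx.
rewrite deriveV; [|exact: u0|exact: du].
by rewrite -exprVn expr2 scaleNr.
Qed.

Lemma is_derive_ln u x v : 0 < u x -> derivable u x v ->
  is_derive x v (fun y => ln (u y)) ((u x)^-1 * 'D_v u x).
Proof.
move=> ux du.
have : is_derive (0 : R) (1 : R) (fun h : R => ln (u (x + h *: v))) ((u x)^-1 * 'D_v u x).
  have d1 : is_derive (0 : R) (1 : R) (fun h : R => u (x + h *: v)) ('D_v u x).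
    by have := @is_derive_line R V u x v 0; rewrite scale0r addr0; apply.
  have ux' : 0 < u (x + (0 : R) *: v) by rewrite scale0r addr0.
  have d2 := is_derive1_ln ux'.
  have [e1 v1] := d1; have [e2 v2] := d2.
  have E := derive1_comp e1 e2.
  split.
    move/derivable1_diffP in e1; move/derivable1_diffP in e2.
    have H := differentiable_comp e1 e2.
    exact/derivable1_diffP.
  by move: E; rewrite !derive1E v1 v2 scale0r addr0.
have E : (fun k : R => k^-1 *: (((fun h : R => ln (u (x + h *: v))) \o shift 0) (k *: 1)
  - ln (u (x + 0 *: v)))) = (fun k => k^-1 *:
    (((fun y => ln (u y)) \o shift x) (k *: v) - ln (u x))).
  by apply/funext => k /=; rewrite addr0 [_%:A]mulr1 scale0r addr0 (addrC x).
by move=> [h1 h2]; split; move: h1 h2; rewrite /derivable /derive E.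
Qed.

Lemma Cn_ln n D u : open D -> (forall x, D x -> 0 < u x) -> Cn n D u
  -> Cn n D (fun x => ln (u x)).
Proof.
move=> oD u0 H.
have c0 : (forall x, D x -> {for x, continuous (fun x => ln (u x))}).
  move=> x Dx; have c1 := Cn_cont H Dx; have c2 := continuous_ln (u0 x Dx).
  exact: (continuous_comp c1 c2).
(* No induction: one derivative turns [ln u] into a quotient, already covered by [CnV] and [CnM]. *)
case: n H => [|n] // cu0; split => // w.
have [cu Hu] := cu0; have [du Cu] := Hu w; split.
  by move=> x Dx; have [] := is_derive_ln (u0 x Dx) (du x Dx).
have Iu := CnV oD (fun x Dx => lt0r_neq0 (u0 x Dx)) (CnW cu0).
apply: Cn_ext (CnM oD Iu Cu) => // x Dx.
by have [_ ->] := is_derive_ln (u0 x Dx) (du x Dx).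
Qed.

Lemma Cn_schwarz D u v w x : open D -> D x -> Cn 2 D u ->
  'D_w ('D_v u) x = 'D_v ('D_w u) x.
Proof.
move=> oD Dx [_ H].
have [dv [_ Hv]] := H v; have [dw [_ Hw]] := H w.
have [dwv cwv] := Hv w; have [dvw cvw] := Hw v.
exact: (schwarz oD Dx dv dw dwv dvw (cwv x Dx) (cvw x Dx)).
Qed.

(** At an interior point the constraint of staying in [D] holds for all small [h], so the restricted
    filter is the full punctured one. *)
Lemma diffquot_within_open {W : normedModType R} D D' (f : V -> W) x v :
  open D' -> D' `<=` D -> D' x ->
  diffquot_within D f x v =
    (h^-1 *: ((f \o shift x) (h *: v) - f x)) @[h --> (0 : R)^'].
Proof.
move=> oD' DD' Dx; rewrite /diffquot_within.
have -> : within [set h : R | D (x + h *: v)] (0 : R)^' = (0 : R)^'.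
  apply/seteqP; split => S /=; last by apply: filterS => h Sh _.
  move=> HS0; have HS : \forall h \near (0 : R)^', D (x + h *: v) -> S h := HS0.
  have c : {for (0 : R), continuous (fun h : R => x + h *: v)}.
    apply: continuousD; first exact: cst_continuous.
    by move=> ?; apply: cvgZr_tmp; exact: cvg_id.
  have N : nbhs (x + (0 : R) *: v) D'.
    by rewrite scale0r addr0; exact: open_nbhs_nbhs.
  have H : \forall h \near (0 : R)^', D (x + h *: v).
    by apply: nbhs_dnbhs; apply: filterS (c _ N) => h /DD'.
  by near=> h; apply: (near HS h) => //; near: h; exact: H.
rewrite (_ : (fun h : R => h^-1 *: (f (x + h *: v) - f x)) =
  (fun h : R => h^-1 *: ((f \o shift x) (h *: v) - f x))) //.
by apply/funext => h /=; rewrite (addrC x).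
Unshelve. all: by end_near. Qed.

Lemma derive_withinE {W : normedModType R} D D' (f : V -> W) x v :
  open D' -> D' `<=` D -> D' x -> derive_within D f x v = 'D_v f x.
Proof.
by move=> oD' DD' Dx; rewrite /derive_within (diffquot_within_open _ _ oD').
Qed.

Lemma Ck_Cn D D' (k : nat) u : open D' -> D' `<=` D -> Ck k D u -> Cn k D' u.
Proof.
move=> oD' DD'.
have c0 (f : V -> R) : {within D, continuous f} -> forall x, D' x
  -> {for x, continuous f}.
  move=> cf x Dx; have cu := (@subspace_continuousP V D R f).1 cf.
  have := cu x (DD' x Dx); rewrite within_interior //.
  by apply: filterS DD' _; exact: open_nbhs_nbhs.
elim: k u => [|k IH] u; first exact: c0.
move=> [cu H]; split; first exact: c0.
move=> v; have [dv cv] := H v; split.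
  by move=> x Dx; have := dv x (DD' x Dx);
    rewrite /derivable_within (diffquot_within_open _ _ oD').
by apply: Cn_ext (IH _ cv) => // x Dx; rewrite (derive_withinE _ _ oD').
Qed.
End SmoothClass.

(** Only times before [t] are compared, because a minimum over a closed time interval may lie at its
    final time. *)
Lemma left_derive_le0 (R : realType) (phi : R -> R) (t d a : R) : a < t
  -> is_derive t (1 : R) phi d ->
  (forall s, a <= s <= t -> phi t <= phi s) -> d <= 0.
Proof.
move=> ta [dphi <-] phimin.
have c : h^-1 *: (phi (h *: 1 + t) - phi t) @[h --> 0^'-] --> 'D_1 phi t.
  have : h^-1 *: (phi (h *: 1 + t) - phi t) @[h --> 0^'] --> 'D_1 phi t by exact: dphi.
  apply: cvg_trans; apply: cvg_app.
  by move=> P [e /= e0 Pe]; exists e => // y ye y0; apply: Pe => //; rewrite lt_eqF.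
have cc : cvg (h^-1 *: (phi (h *: 1 + t) - phi t) @[h --> 0^'-]) by apply/cvg_ex;
  eexists; exact: c.
rewrite -(cvg_lim _ c) //.
apply: limr_le => //.
near=> h.
have h0 : h < 0 by near: h; exact: nbhs_left_lt.
have ha : a - t < h by near: h; apply: nbhs_left_gt; rewrite subr_lt0.
rewrite [_ *: _]mulrC; apply: mulr_ge0_le0; last by rewrite invr_le0 ltW.
rewrite subr_ge0 [h *: _]mulr1; apply: phimin; apply/andP; split; lra.
Unshelve. all: by end_near. Qed.

(** * The ring of smooth functions on an open set *)

Section SmoothRing.
Context {R : realType} {V : normedModType R}.

(* Vanishing off [D] makes equality in the ring equality on [D]; the unit of the
   ring is the indicator of [D]. *)
Record smfun (D : set V) (oD : open D) := Smfun {
  smfun_val :> V -> R;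
  smfun_Cn : forall n, Cn n D smfun_val;
  smfun_out : forall x, ~ D x -> smfun_val x = 0
}.

Context (D : set V) (oD : open D).
Implicit Types (f g h : smfun oD) (x v w : V) (u : V -> R).

Lemma smfunP f g : (forall x, D x -> f x = g x) -> f = g.
Proof.
case: f g => [f cf zf] [g cg zg] /= fg.
have E : f = g.
  by apply/funext => x; have [/fg//|nD] := pselect (D x); rewrite zf // zg.
by case: _ / E cg zg => cg zg; congr Smfun; exact: Prop_irrelevance.
Qed.

Arguments smfun_val : simpl never.

Definition cutoff u x : R := if `[< D x >] then u x else 0.

Lemma cutoff_in u x : D x -> cutoff u x = u x.
Proof. by move=> Dx; rewrite /cutoff asboolT. Qed.

Lemma cutoff_out u x : ~ D x -> cutoff u x = 0.
Proof. by move=> Dx; rewrite /cutoff asboolF. Qed.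

Lemma cutoff_Cn u : (forall n, Cn n D u) -> forall n, Cn n D (cutoff u).
Proof. by move=> H n; apply: Cn_ext (H n) => // x Dx; rewrite cutoff_in. Qed.

(* The operations are sealed by [Qed] in order to keep unification from
   unfolding them down to limits of difference quotients. *)
Fact smk_subproof : {F : forall u, (forall n, Cn n D u) -> smfun oD |
  forall u H x, D x -> F u H x = u x}.
Proof.
by exists (fun u H => Smfun oD (cutoff_Cn H) (@cutoff_out u)) => u H x Dx;
  exact: cutoff_in.
Qed.

Definition smk : forall u, (forall n, Cn n D u) -> smfun oD := sval smk_subproof.

Lemma smkE u (H : forall n, Cn n D u) x : D x -> smk H x = u x.
Proof. exact: (svalP smk_subproof). Qed.

Fact sadd_subproof : {F : smfun oD -> smfun oD -> smfun oD | forall f g x, D x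
  -> F f g x = f x + g x}.
Proof.
exists (fun f g => smk (fun n => CnD oD (smfun_Cn f n) (smfun_Cn g n))) => f g x.
exact: smkE.
Qed.
Fact sopp_subproof : {F : smfun oD -> smfun oD | forall f x, D x -> F f x = - f x}.
Proof. by exists (fun f => smk (fun n => CnN oD (smfun_Cn f n))) => f x; exact: smkE. Qed.
Fact smul_subproof : {F : smfun oD -> smfun oD -> smfun oD | forall f g x, D x
  -> F f g x = f x * g x}.
Proof.
exists (fun f g => smk (fun n => CnM oD (smfun_Cn f n) (smfun_Cn g n))) => f g x.
exact: smkE.
Qed.
Fact sconst_subproof : {F : R -> smfun oD | forall c x, D x -> F c x = c}.
Proof. by exists (fun c => smk (fun n => Cn_cst n D c)) => c x; exact: smkE. Qed.

Definition sadd : smfun oD -> smfun oD -> smfun oD := sval sadd_subproof.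
Definition sopp : smfun oD -> smfun oD := sval sopp_subproof.
Definition smul : smfun oD -> smfun oD -> smfun oD := sval smul_subproof.
Definition sconst : R -> smfun oD := sval sconst_subproof.

Lemma saddE f g x : D x -> sadd f g x = f x + g x.
Proof. exact: (svalP sadd_subproof). Qed.
Lemma soppE f x : D x -> sopp f x = - f x.
Proof. exact: (svalP sopp_subproof). Qed.
Lemma smulE f g x : D x -> smul f g x = f x * g x.
Proof. exact: (svalP smul_subproof). Qed.
Lemma sconstE c x : D x -> sconst c x = c.
Proof. exact: (svalP sconst_subproof). Qed.

HB.instance Definition _ := gen_eqMixin (smfun oD).
HB.instance Definition _ := gen_choiceMixin (smfun oD).

Lemma saddA : associative sadd.
Proof. by move=> f g h; apply: smfunP => x Dx;
  rewrite !(saddE, soppE, smulE, sconstE) // addrA. Qed.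
Lemma saddC : commutative sadd.
Proof. by move=> f g; apply: smfunP => x Dx;
  rewrite !(saddE, soppE, smulE, sconstE) // addrC. Qed.
Lemma sadd0 : left_id (sconst 0) sadd.
Proof. by move=> f; apply: smfunP => x Dx;
  rewrite !(saddE, soppE, smulE, sconstE) // add0r. Qed.
Lemma saddN : left_inverse (sconst 0) sopp sadd.
Proof. by move=> f; apply: smfunP => x Dx;
  rewrite !(saddE, soppE, smulE, sconstE) // addNr. Qed.
HB.instance Definition _ := GRing.isZmodule.Build (smfun oD) saddA saddC sadd0 saddN.

Lemma smulA : associative smul.
Proof. by move=> f g h; apply: smfunP => x Dx;
  rewrite !(saddE, soppE, smulE, sconstE) // mulrA. Qed.
Lemma smulC : commutative smul.
Proof. by move=> f g; apply: smfunP => x Dx;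
  rewrite !(saddE, soppE, smulE, sconstE) // mulrC. Qed.
Lemma smul1 : left_id (sconst 1) smul.
Proof. by move=> f; apply: smfunP => x Dx;
  rewrite !(saddE, soppE, smulE, sconstE) // mul1r. Qed.
Lemma smulDl : left_distributive smul sadd.
Proof. by move=> f g h; apply: smfunP => x Dx;
  rewrite !(saddE, soppE, smulE, sconstE) // mulrDl. Qed.
HB.instance Definition _ := GRing.Zmodule_isComPzRing.Build
  (smfun oD) smulA smulC smul1 smulDl.

Lemma smfunDE f g x : (f + g) x = f x + g x.
Proof.
have [Dx|nDx] := pselect (D x); first exact: saddE.
by rewrite !(smfun_out _ nDx) addr0.
Qed.
Lemma smfunNE f x : (- f) x = - f x.
Proof.
have [Dx|nDx] := pselect (D x); first exact: soppE.
by rewrite !(smfun_out _ nDx) oppr0.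
Qed.
Lemma smfunME f g x : (f * g) x = f x * g x.
Proof.
have [Dx|nDx] := pselect (D x); first exact: smulE.
by rewrite !(smfun_out _ nDx) mulr0.
Qed.
Lemma smfun0E x : (0 : smfun oD) x = 0.
Proof.
have [Dx|nDx] := pselect (D x); first exact: sconstE.
by rewrite !(smfun_out _ nDx).
Qed.
Lemma smfun1E x : D x -> (1 : smfun oD) x = 1.
Proof. exact: sconstE. Qed.

Lemma sd_Cn v f : forall n, Cn n D ('D_v f).
Proof. by move=> n; have [_ /(_ v)[]] := smfun_Cn f n.+1. Qed.

Fact sd_subproof : {F : V -> smfun oD -> smfun oD |
  forall v f x, D x -> F v f x = 'D_v f x}.
Proof. by exists (fun v f => smk (sd_Cn v f)) => v f x; exact: smkE. Qed.

Definition sd : V -> smfun oD -> smfun oD := sval sd_subproof.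

Lemma smfun_derivable v f x : D x -> derivable f x v.
Proof. by move=> Dx; have [_ /(_ v)[+ _]] := smfun_Cn f 1; apply. Qed.

Lemma sdE v f x : D x -> sd v f x = 'D_v f x.
Proof. exact: (svalP sd_subproof). Qed.

Lemma sdD v f g : sd v (f + g) = sd v f + sd v g.
Proof.
apply: smfunP => x Dx; rewrite smfunDE !(sdE v _ Dx).
rewrite -deriveD; [|exact: smfun_derivable..].
by congr ('D_v _ x); apply/funext => y; rewrite smfunDE.
Qed.

Lemma sdM v f g : sd v (f * g) = sd v f * g + f * sd v g.
Proof.
apply: smfunP => x Dx; rewrite smfunDE !smfunME !(sdE v _ Dx).
rewrite (_ : (f * g : smfun oD) = (f : V -> R) * (g : V -> R) :> (V -> R)); last first.
  by apply/funext => y; rewrite smfunME.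
rewrite deriveM; [|exact: smfun_derivable..].
by rewrite addrC; congr (_ + _); rewrite mulrC.
Qed.

Lemma sdC v w f : sd v (sd w f) = sd w (sd v f).
Proof.
apply: smfunP => x Dx.
transitivity ('D_v ('D_w f) x).
  rewrite (sdE v _ Dx).
  apply: near_eq_derive; apply: (near_open oD Dx) => y Dy; exact: sdE.
transitivity ('D_w ('D_v f) x); last first.
  rewrite (sdE w _ Dx); apply: esym.
  apply: near_eq_derive; apply: (near_open oD Dx) => y Dy; exact: sdE.
exact: (@Cn_schwarz R V D f w v x oD Dx (smfun_Cn f 2)).
Qed.
End SmoothRing.

(** * Derivative tests at a minimum *)

Section Minimum.
Context {R : realType} {V : normedModType R} (D : set V) (oD : open D).
Implicit Types (f : smfun oD) (x v w : V).

Lemma sd_linear (a b : R) v w f :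
  sd (a *: v + b *: w) f = sconst oD a * sd v f + sconst oD b * sd w f.
Proof.
apply: smfunP => x Dx; rewrite smfunDE !smfunME !(sdE _ _ Dx) !sconstE //.
have c u : {for x, continuous ('D_u f)} by exact: (Cn_cont (sd_Cn u f 0) Dx).
have d u y : D y -> derivable f y u by exact: smfun_derivable.
by have [_ ->] := is_derive_linear a b oD Dx (d v) (c v) (d w) (c w).
Qed.

Lemma sdN v f : sd (- v) f = - sd v f.
Proof.
rewrite (_ : - v = (-1) *: v + 0 *: v); last by rewrite scaleN1r scale0r addr0.
rewrite sd_linear; apply: smfunP => x Dx; rewrite smfunDE smfunNE !smfunME !sconstE //.
by rewrite mulN1r mul0r addr0.
Qed.

Lemma near_line x v : D x -> exists2 d : R, 0 < d & forall h : R, `|h| < d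
  -> D (x + h *: v).
Proof.
move=> Dx; have : nbhs x D by exact: open_nbhs_nbhs.
move=> /nbhs_normP[d /= d0 H].
have e1 : 0 < 1 + `|v| by rewrite ltr_pwDl.
exists (d / (1 + `|v|)); first by rewrite divr_gt0.
move=> h hd; apply: H => /=; rewrite /ball_ /= opprD addrA subrr sub0r normrN normrZ.
rewrite ltr_pdivlMr // in hd; apply: le_lt_trans hd.
by rewrite ler_wpM2l // lerDr.
Qed.

Lemma sd_min f x v : D x ->
  (forall h : R, D (x + h *: v) -> f x <= f (x + h *: v)) ->
  sd v f x = 0 /\ 0 <= sd v (sd v f) x.
Proof.
move=> Dx fmin; have [d d0 Hd] := near_line v Dx.
have dl h : `|h| < d -> is_derive h (1 : R) (fun s : R => f (x + s *: v))
  (sd v f (x + h *: v)).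
  move=> hd; rewrite (sdE _ _ (Hd h hd)); apply: is_derive_line.
  by apply: smfun_derivable; exact: Hd.
have itvd h : h \in `](- d), d[ -> `|h| < d by rewrite in_itv /= ltr_norml.
split.
  have m : is_derive (0 : R) (1 : R) (fun s : R => f (x + s *: v)) 0.
    apply: (@derive1_at_min R _ (- d) d 0).
    - lra.
    - by move=> t /itvd td; have [] := dl t td.
    - by rewrite in_itv /=; apply/andP; split; lra.
    - by move=> t /itvd td; rewrite scale0r addr0; apply: fmin; exact: Hd.
  have d0' : `|0 : R| < d by rewrite normr0.
  have [_ E1] := dl 0 d0'; have [_ E2] := m.
  by rewrite -[in LHS](addr0 x) -(scale0r v) -E1 E2.
apply/ler_addgt0Pl => eps eps0.
(* The second difference is taken with [w = - v]: its numerator 2 f(x) - f(x + h v) - f(x - h v) is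
   nonpositive at a minimum, and its quotient by h^2 tends to minus the second derivative. *)
have cf : {for x, continuous ('D_(- v) ('D_v f))}.
  have [_ /(_ v)[_ [_ /(_ (- v))[_ c]]]] := smfun_Cn f 2; exact: c.
have dv y : D y -> derivable f y v by exact: smfun_derivable.
have dvv y : D y -> derivable ('D_v f) y (- v).
  by have [_ /(_ v)[_ [_ /(_ (- v))[c _]]]] := smfun_Cn f 2; exact: c.
have [d2 d20 H] := second_difference oD Dx eps0 dv dvv cf.
have m0 : 0 < Num.min d d2 by rewrite lt_min d0 d20.
pose h := Num.min d d2 / 2.
have : h < Num.min d d2 by rewrite /h; lra.
rewrite lt_min => /andP[hd hd2].
have h0 : 0 < h by rewrite divr_gt0.
have := H h; rewrite h0 hd2 => /(_ isT).
have -> : 'D_(- v) ('D_v f) x = - sd v (sd v f) x.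
  rewrite -smfunNE -sdN (sdE _ _ Dx).
  by apply: near_eq_derive; apply: (near_open oD Dx) => y Dy; apply/esym; exact: sdE.
have E1 : f x <= f (x + h *: v) by apply: fmin; apply: Hd; rewrite gtr0_norm.
have E2 : f x <= f (x + h *: (- v)).
  rewrite scalerN -scaleNr; apply: fmin; apply: Hd; rewrite normrN gtr0_norm //.
have -> : x + h *: v + h *: (- v) = x by rewrite scalerN addrK.
rewrite opprK.
have q0 : (f x - f (x + h *: v) - f (x + h *: (- v)) + f x) / h ^+ 2 <= 0.
  by apply: mulr_le0_ge0; [lra | rewrite invr_ge0 exprn_ge0 // ltW].
have K (q A : R) : q <= 0 -> `|q + A| <= eps -> 0 <= eps + A.
  by rewrite ler_norml => ? /andP[? _]; lra.
exact: K q0.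
Qed.
Lemma sd_sconst v (c : R) : sd v (sconst oD c) = 0.
Proof.
apply: smfunP => x Dx; rewrite (sdE _ _ Dx) smfun0E -(derive_cst c x v).
by apply: near_eq_derive; apply: (near_open oD Dx) => y; exact: sconstE.
Qed.

(** Brings the second derivative along the vector chosen in [lap_min] to the form assumed in
    [ev_Lap_ge0]. *)
Lemma sd2_linear (a b : R) v w f x : D x ->
  sd (a *: v + b *: w) (sd (a *: v + b *: w) f) x =
  a ^+ 2 * sd v (sd v f) x + 2 * a * b * sd v (sd w f) x + b ^+ 2 * sd w (sd w f) x.
Proof.
move=> Dx; set ca := sconst oD a; set cb := sconst oD b.
have E1 : sd (a *: v + b *: w) f = ca * sd v f + cb * sd w f := sd_linear a b v w f.
have E2 u : sd u (ca * sd v f + cb * sd w f) = ca * sd u (sd v f) + cb * sd u (sd w f).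
  rewrite sdD (sdM u ca) (sdM u cb) (sd_sconst u a) (sd_sconst u b).
  by rewrite !mul0r !add0r.
rewrite E1 (sd_linear a b v w) (E2 v) (E2 w) (sdC w v f).
move: (sd v (sd v f)) (sd v (sd w f)) (sd w (sd w f)) => f1 f2 f3.
rewrite smfunDE 2!smfunME 2!smfunDE 4!smfunME /ca /cb (sconstE oD a Dx) (sconstE oD b Dx).
by ring.
Qed.
End Minimum.

(** * Geometry of one chart *)

Section Chart.
Context {R : realType}.
Local Notation E := 'rV[R]_2.
Local Notation Z := (R * E)%type.

(** Time 0 is left out so that the space-time domain is open and derivatives are two-sided. *)
Definition opentime (T : \bar R) : set R := [set t | 0 < t /\ (t%:E < T)%E].

Lemma open_opentime T : open (opentime T).
Proof.
have -> : opentime T = [set t : R | 0 < t] `&` [set t : R | (t%:E < T)%E] by [].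
apply: openI; first exact: open_gt.
case: T => [r||].
- rewrite (_ : [set t : R | _] = [set t : R | t < r]); first exact: open_lt.
  by apply/seteqP; split => t /=; rewrite lte_fin.
- rewrite (_ : [set t : R | _] = setT); first exact: openT.
  by apply/seteqP; split => t //= _; rewrite ltry.
- rewrite (_ : [set t : R | _] = set0); first exact: open0.
  by apply/seteqP; split => t //=.
Qed.

Context (T : \bar R) (C : set E) (oC : open C).

Definition spacetime : set Z := opentime T `*` C.

Lemma open_spacetime : open spacetime.
Proof.
rewrite openE => -[t x] [/= ot Cx]; exists (opentime T, C) => //=.
by split; apply: open_nbhs_nbhs; split=> //; exact: open_opentime.
Qed.
Local Notation S := (smfun open_spacetime).

Definition dx (a : 'I_2) : S -> S := sd (0 : R, delta_mx 0 a : E).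
Definition dt : S -> S := sd (1 : R, 0 : E).
Definition shalf : S := sconst open_spacetime 2^-1.

Lemma shalf2 : shalf + shalf = 1.
Proof. 
apply: smfunP => z Dz; rewrite smfunDE smfun1E // sconstE //=; lra.
Qed.

Lemma smfun_sumE (I : Type) (r : seq I) (P : pred I) (F : I -> S) z :
  (\sum_(i <- r | P i) F i) z = \sum_(i <- r | P i) F i z.
Proof.
elim/big_rec2: _ => [|i x y _ <-]; first exact: smfun0E.
exact: smfunDE.
Qed.

Lemma is_derive_dx (a : 'I_2) (U : S) t x (u : E -> R) : spacetime (t, x) ->
  (forall y, C y -> u y = U (t, y)) ->
  is_derive x (delta_mx 0 a : E) u (dx a U (t, x)).
Proof.
move=> Dz uU; have [_ Cx] := Dz.
have e (h : R) : h *: (0 : R, delta_mx 0 a : E) + (t, x)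
  = (t, h *: (delta_mx 0 a : E) + x).
  by rewrite -[RHS](congr1 (fun r => (r, _)) (_ : h *: (0 : R) + t = t)) // scaler0 add0r.
have q : (fun h : R => h^-1 *: ((U \o shift (t, x)) (h *: (0 : R, delta_mx 0 a : E))
  - U (t, x))) =
   (fun h : R => h^-1 *: (((fun y => U (t, y)) \o shift x) (h *: (delta_mx 0 a : E))
     - U (t, x))).
  by apply/funext => h /=; rewrite e.
have c := @smfun_derivable R _ _ _ (0 : R, delta_mx 0 a : E) U _ Dz.
have d : is_derive x (delta_mx 0 a : E) (fun y => U (t, y))
  ('D_(0 : R, delta_mx 0 a : E) U (t, x)).
  by rewrite /derivable q in c; split; [exact: c | rewrite /derive q].
rewrite /dx (sdE _ _ Dz).
apply: near_eq_is_derive d; apply: (near_open oC Cx) => y Cy; exact/esym/uU.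
Qed.

Lemma partialE (a : 'I_2) (U : S) t (u : E -> R) : opentime T t ->
  (forall y, C y -> u y = U (t, y)) ->
  forall x, C x -> partial a u x = dx a U (t, x).
Proof.
by move=> ot uU x Cx; have [_] := @is_derive_dx a U t x u (conj ot Cx) uU.
Qed.

Lemma is_derive_dt (U : S) t x (u : R -> R) : spacetime (t, x) ->
  (forall s, opentime T s -> u s = U (s, x)) ->
  is_derive t (1 : R) u (dt U (t, x)).
Proof.
move=> Dz uU; have ot : opentime T t by case: Dz.
have e (h : R) : h *: (1 : R, 0 : E) + (t, x) = (h *: (1 : R) + t, x).
  by rewrite -[RHS](congr1 (fun r => (_, r)) (_ : h *: (0 : E) + x = x)) // scaler0 add0r.
have q : (fun h : R => h^-1 *: ((U \o shift (t, x)) (h *: (1 : R, 0 : E)) - U (t, x))) =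
   (fun h : R => h^-1 *: (((fun s => U (s, x)) \o shift t) (h *: (1 : R)) - U (t, x))).
  by apply/funext => h /=; rewrite e.
have c := @smfun_derivable R _ _ _ (1 : R, 0 : E) U _ Dz.
have d : is_derive t (1 : R) (fun s => U (s, x)) ('D_(1 : R, 0 : E) U (t, x)).
  by rewrite /derivable q in c; split; [exact: c | rewrite /derive q].
rewrite /dt (sdE _ _ Dz).
have N : \forall s \near t, U (s, x) = u s.
  have o : nbhs t (opentime T) by apply: open_nbhs_nbhs; split => //;
    exact: open_opentime.
  by near=> s; apply/esym/uU; near: s.
exact: near_eq_is_derive N d.
Unshelve. all: by end_near.
Qed.

Lemma ddtE (U : S) t x (u : R -> R) : spacetime (t, x) ->
  (forall s, opentime T s -> u s = U (s, x)) -> ddt u t = dt U (t, x).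
Proof.
move=> Dz uU; have [_ <-] := is_derive_dt Dz uU.
have [[t0 _] _] := Dz.
have o : open [set s : R | 0 < s] by exact: open_gt.
rewrite /ddt (@derive_withinE R R R [set s : R | 0 <= s] [set s : R | 0 < s] u t 1) //.
by move=> s /= /ltW.
Qed.
End Chart.

Lemma quad_formE (R : comPzRingType) (M : 'M[R]_2) (v : 'rV[R]_2) :
  (v *m M *m v^T) 0 0 = \sum_a \sum_b M a b * v 0 a * v 0 b.
Proof. by rewrite mxE big_ord2 !mxE !big_ord2; ring. Qed.

(** * The coordinate geometry of the definitions, identified with that of the ring *)

Section Geometry.
Context {R : realType} (T : \bar R) (C : set 'rV[R]_2) (oC : open C).
Local Notation E := 'rV[R]_2.
Local Notation Z := (R * E)%type.
Context (G : R -> E -> 'M[R]_2).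
Local Notation D := (spacetime T C).
Context (G_smooth : forall a b n, Cn n D (fun z : Z => G z.1 z.2 a b)).
Context (G_sym : forall t x, opentime T t -> C x -> (G t x)^T = G t x).
Context (G_pos : forall t x, opentime T t -> C x -> forall v : E, v != 0 ->
  0 < (v *m G t x *m v^T) 0 0).
Local Notation oD := (@open_spacetime R T C oC).
Local Notation S := (smfun oD).

Definition gS a b : S := smk oD (G_smooth a b).

Lemma gSE a b t x : D (t, x) -> gS a b (t, x) = G t x a b.
Proof. exact: smkE. Qed.

Lemma G10 t x : D (t, x) -> G t x 1 0 = G t x 0 1.
Proof. by case=> ot Cx; rewrite -[in LHS](G_sym ot Cx) mxE. Qed.

Lemma quadG t x (a b : R) : D (t, x) -> (a, b) != 0 ->
  0 < a ^+ 2 * G t x 0 0 + a * b * G t x 0 1 *+ 2 + b ^+ 2 * G t x 1 1.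
Proof.
move=> Dz ab; have [ot Cx] := Dz.
pose v : E := \row_i if i == 0 then a else b.
have v0 : v != 0.
  apply: contraNneq ab => v0; have := congr1 (fun w : E => w 0 0) v0.
  have := congr1 (fun w : E => w 0 1) v0.
  by rewrite /v !mxE /= => -> ->.
have := G_pos ot Cx v0; rewrite !mxE !big_ord2 !mxE !big_ord2 !mxE /= (G10 Dz).
by congr (_ < _); ring.
Qed.

Lemma G00_gt0 t x : D (t, x) -> 0 < G t x 0 0.
Proof.
move=> Dz; have n : (1 : R, 0 : R) != 0 by apply/eqP => -[] /eqP; rewrite oner_eq0.
by have := quadG Dz n; congr (_ < _); ring.
Qed.

Lemma G11_gt0 t x : D (t, x) -> 0 < G t x 1 1.
Proof.
move=> Dz; have n : (0 : R, 1 : R) != 0 by apply/eqP => -[] /eqP; rewrite oner_eq0.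
by have := quadG Dz n; congr (_ < _); ring.
Qed.

Definition detG (z : Z) : R := G z.1 z.2 0 0 * G z.1 z.2 1 1 - G z.1 z.2 0 1
  * G z.1 z.2 0 1.

Lemma detG_gt0 z : D z -> 0 < detG z.
Proof.
case: z => t x Dz; have g0 := G00_gt0 Dz.
(* Positivity is tested on the vector (- g01, g00), whose squared length is g00 times the
   determinant. *)
have := @quadG t x (- G t x 0 1) (G t x 0 0) Dz.
have -> : (- G t x 0 1) ^+ 2 * G t x 0 0 + - G t x 0 1 * G t x 0 0 * G t x 0 1 *+ 2
  + G t x 0 0 ^+ 2 * G t x 1 1 = G t x 0 0 * detG (t, x).
  by rewrite /detG /=; ring.
rewrite pmulr_rgt0 //; apply.
by apply/eqP => -[] _ /eqP; rewrite gt_eqF.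
Qed.

Lemma detG_Cn n : Cn n D detG.
Proof.
have oD' := oD.
apply: CnD => //; first exact: CnM.
by apply: CnN => //; exact: CnM.
Qed.

Definition dinvS : S :=
  smk oD (fun n => CnV oD (fun z Dz => lt0r_neq0 (detG_gt0 Dz)) (detG_Cn n)).

Lemma gS10 : gS 1 0 = gS 0 1.
Proof. by apply: smfunP => -[t x] Dz; rewrite !gSE // G10. Qed.

Lemma dinvS_det : dinvS * (gS 0 0 * gS 1 1 - gS 0 1 * gS 0 1) = 1.
Proof.
apply: smfunP => -[t x] Dz; rewrite smfunME smfunDE smfunNE !smfunME !gSE // smkE
  // smfun1E //.
by rewrite mulVf // gt_eqF // (detG_gt0 Dz).
Qed.

Lemma invmx2 (M N : 'M[R]_2) : M *m N = 1%:M -> invmx M = N.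
Proof.
move=> MN; have Mu : M \in unitmx by have [] := mulmx1_unit MN.
by rewrite -[RHS](mulKmx Mu) MN mulmx1.
Qed.

Local Notation giS := (@gi _ gS dinvS).

Lemma ginvE t x a b : D (t, x) -> ginv (G t) x a b = giS a b (t, x).
Proof.
move=> Dz; rewrite /ginv (@invmx2 _ (\matrix_(a, b) giS a b (t, x))) ?mxE //.
apply/matrixP => i j; rewrite !mxE big_ord2 !mxE.
have := congr1 (fun f : S => f (t, x)) (gKr gS10 dinvS_det i j).
rewrite smfunDE !smfunME !gSE // => e.
have sg k l : G t x k l = G t x l k.
  by elim/ord2_ind: k; elim/ord2_ind: l; rewrite ?G10.
rewrite !(sg i) e; case: (i == j); [exact: smfun1E|exact: smfun0E].
Qed.

Local Notation GamS := (@Gam _ (@dx R T C oC) (@shalf R T C oC) gS dinvS).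

Lemma christoffelE t c a b x : D (t, x) ->
  christoffel (G t) c a b x = GamS c a b (t, x).
Proof.
move=> Dz; rewrite /christoffel /Gam -lock smfunME sconstE // smfun_sumE; congr (_ * _).
apply: eq_bigr => d _; have [ot Cx] := Dz.
have p e k l : partial e (fun y => G t y k l) x = dx e (gS k l) (t, x).
  by apply: partialE => // y Cy; rewrite gSE.
by rewrite ginvE // !p smfunME !smfunDE smfunNE.
Qed.

Local Notation RicS := (@Ric _ (@dx R T C oC) (@shalf R T C oC) gS dinvS).

Lemma ricciE t a b x : D (t, x) -> ricci (G t) a b x = RicS a b (t, x).
Proof.
move=> Dz; rewrite /ricci /Ric smfun_sumE; apply: eq_bigr => c _.
have [ot Cx] := Dz.
have p e k l m : partial e (christoffel (G t) k l m) x = dx e (GamS k l m) (t, x).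
  by apply: partialE => // y Cy; rewrite christoffelE.
rewrite !p !smfunDE smfunNE smfun_sumE; congr (_ + _).
apply: eq_bigr => d _; rewrite !(christoffelE _ _ _ Dz).
by move: (GamS c c d) (GamS d a b) (GamS c a d) (GamS d c b) => f1 f2 f3 f4;
  rewrite smfunDE smfunNE !smfunME.
Qed.

Local Notation ScalS := (@Scal _ (@dx R T C oC) (@shalf R T C oC) gS dinvS).

Lemma scalar_curvatureE t x : D (t, x) -> scalar_curvature (G t) x = ScalS (t, x).
Proof.
move=> Dz; rewrite /scalar_curvature /Scal -lock smfun_sumE; apply: eq_bigr => a _.
rewrite smfun_sumE; apply: eq_bigr => b _.
by rewrite ginvE // ricciE // smfunME.
Qed.

Local Notation LapS := (@Lap _ (@dx R T C oC) (@shalf R T C oC) gS dinvS).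

Lemma laplacianE t x (u : E -> R) (U : S) : D (t, x) ->
  (forall y, C y -> u y = U (t, y)) -> laplacian (G t) u x = LapS U (t, x).
Proof.
move=> Dz uU; have [ot Cx] := Dz.
rewrite /laplacian /Lap smfun_sumE; apply: eq_bigr => a _.
rewrite smfun_sumE; apply: eq_bigr => b _.
rewrite ginvE // smfunME; congr (_ * _).
have p e y : C y -> partial e u y = dx e U (t, y) by exact: partialE.
rewrite /hessian /Hess smfunDE smfunNE smfun_sumE
  (@partialE _ _ _ oC a (dx b U) t _ ot (p b) x Cx).
congr (_ - _); apply: eq_bigr => c _.
by rewrite christoffelE // p // smfunME.
Qed.

Local Notation ipS := (@ip _ (@dx R T C oC) gS dinvS).

Lemma metric_norm_gradientE t x (u : E -> R) (U : S) : D (t, x) ->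
  (forall y, C y -> u y = U (t, y)) ->
  metric_norm (G t) x (gradient (G t) u x) ^+ 2 = ipS U U (t, x).
Proof.
move=> Dz uU; have [ot Cx] := Dz.
have p e : partial e u x = dx e U (t, x) by exact: partialE.
set v := gradient _ _ _.
have sE : \sum_a \sum_b G t x a b * v 0 a * v 0 b = ipS U U (t, x).
  have gv b : \sum_a G t x a b * v 0 a = partial b u x.
    have K d : \sum_a G t x a b * ginv (G t) x a d = (b == d)%:R.
      rewrite big_ord2 !ginvE //.
      have := congr1 (fun f : S => f (t, x)) (gKr gS10 dinvS_det b d).
      rewrite smfunDE !smfunME !gSE // => e.
      rewrite e; case: (b == d); [exact: smfun1E|exact: smfun0E].
    have := K 0; have := K 1; rewrite !big_ord2 !mxE !big_ord2.
    set g0 := ginv _ _ 0 0; set g1 := ginv _ _ 0 1; set g2 := ginv _ _ 1 0;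
      set g3 := ginv _ _ 1 1.
    move=> K1 K0; transitivity ((b == 0)%:R * partial 0 u x + (b == 1)%:R
      * partial 1 u x).
      rewrite -K1 -K0 {K K0 K1}; move: (partial 0 u x) (partial 1 u x) g0 g1 g2 g3
        (G t x 0 b) (G t x 1 b).
      by move=> *; ring.
    by elim/ord2_ind: b {K K1 K0} => /=; rewrite mul1r mul0r ?addr0 ?add0r.
  rewrite exchange_big /=; transitivity (\sum_b partial b u x * v 0 b).
    by apply: eq_bigr => b _; rewrite -mulr_suml gv.
  rewrite /ip smfun_sumE; apply: eq_bigr => a _.
  rewrite mxE smfun_sumE mulr_sumr; apply: eq_bigr => b _.
  by rewrite ginvE // !smfunME !p mulrCA.
rewrite /metric_norm sE sqr_sqrtr //.
rewrite -sE.
have [v0|v0] := eqVneq v 0.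
  by rewrite big1 // => a _; rewrite big1 // => b _; rewrite v0 !mxE !mulr0.
by have := G_pos ot Cx v0; rewrite quad_formE => /ltW.
Qed.

Lemma giS_val z : D z ->
  [/\ giS 0 0 z = (detG z)^-1 * G z.1 z.2 1 1,
      giS 0 1 z = - ((detG z)^-1 * G z.1 z.2 0 1),
      giS 1 0 z = - ((detG z)^-1 * G z.1 z.2 0 1) &
      giS 1 1 z = (detG z)^-1 * G z.1 z.2 0 0].
Proof.
case: z => t x Dz; rewrite /gi -!lock !smfunNE !smfunME !gSE //.
by have -> : dinvS (t, x) = (detG (t, x))^-1 := smkE _ _ Dz.
Qed.

Lemma giS_pos z : D z ->
  0 < giS 0 0 z /\ 0 < giS 0 0 z * giS 1 1 z - giS 0 1 z * giS 0 1 z.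
Proof.
case: z => t x Dz; have [-> -> _ ->] := giS_val Dz.
have dp := detG_gt0 Dz.
have d0 : 0 < (detG (t, x))^-1 by rewrite invr_gt0.
split; first by rewrite mulr_gt0 //; exact: (G11_gt0 Dz).
have e : (detG (t, x))^-1 * detG (t, x) = 1 by rewrite mulVf // gt_eqF.
move: d0 e; generalize (detG (t, x))^-1 => d d0 e.
rewrite [X in 0 < X](_ : _ = d * (d * detG (t, x))); first by rewrite e mulr1.
by rewrite /detG /=; ring.
Qed.

Lemma lap_min (q : S) t x : D (t, x) -> (forall y, C y -> q (t, x) <= q (t, y)) ->
  [/\ dx 0 q (t, x) = 0, dx 1 q (t, x) = 0 & 0 <= LapS q (t, x)].
Proof.
move=> Dz qmin; have [a0 d0] := giS_pos Dz.
have H (v : E) : sd (0 : R, v) q (t, x) = 0 /\ 0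
  <= sd (0 : R, v) (sd (0 : R, v) q) (t, x).
  apply: sd_min => // h; rewrite (_ : (t, x) + h *: (0 : R, v) = (t, x + h *: v)).
    by move=> [_ Cy]; exact: qmin.
  by rewrite -[RHS](congr1 (fun r => (r, _)) (_ : t + h *: (0 : R) = t)) // scaler0 addr0.
have [d0q _] := H (delta_mx 0 0); have [d1q h1] := H (delta_mx 0 1).
split; [exact: d0q | exact: d1q | ].
have E2 (a b : R) : (0 : R, a *: delta_mx 0 0 + b *: delta_mx 0 1 : E) =
    a *: (0 : R, delta_mx 0 0 : E) + b *: (0 : R, delta_mx 0 1 : E).
  rewrite -[LHS](congr1 (fun r => (r, _)) (_ : a *: (0 : R) + b *: (0 : R) = 0)) //.
  by rewrite !scaler0 addr0.
(* The vector is the first row of the inverse metric at this point, as [ev_Lap_ge0] requires. *)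
have [_] := H (giS 0 0 (t, x) *: delta_mx 0 0 + giS 0 1 (t, x) *: delta_mx 0 1).
rewrite E2 (sd2_linear _ _ _ _ _ Dz) => hv.
exact: (@ev_Lap_ge0 S (@dx R T C oC) (@shalf R T C oC) (fun i j => @sdC R _ _ _ _ _)
  gS dinvS R (fun f : S => f (t, x)) (fun u v => smfunDE u v _) (fun u v =>
    smfunME u v _) a0 d0 q
  d0q d1q h1 hv).
Qed.
End Geometry.

(** * The flow on the surface *)

Section Surface.
Context {R : realType} {M : topologicalType} (A : surface_atlas R M).
Local Notation E := 'rV[R]_2.
Implicit Types (i j : idx A) (p q : M).

Definition open_cod i : open (cod i) := @cod_open R M A i.

Definition tau i j (y : E) : E := chart j (ichart i y).

Definition jac i j (x : E) (a c : 'I_2) : R := partial a (fun y => tau i j y 0 c) x.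

Lemma cod_chart i p : dom i p -> cod i (chart i p).
Proof. by move=> ip; exists p. Qed.

Lemma tau_chart i j p : dom i p -> tau i j (chart i p) = chart j p.
Proof. by move=> ip; rewrite /tau chartK. Qed.

(** Openness makes the derivatives in [transition_smooth] two-sided. *)
Lemma open_overlap i j : open (chart i @` (dom i `&` dom j)).
Proof.
rewrite openE => _ [p [ip jp] <-].
have cx : cod i (chart i p) by exact: cod_chart.
have ci := (@subspace_continuousP E (cod i) M (ichart i)).1
  (ichart_continuous (s:=A) (i:=i)) _ cx.
have nj : nbhs (ichart i (chart i p)) (dom j).
  by rewrite chartK //; apply: open_nbhs_nbhs; split => //; exact: (@dom_open R M A j).
have H : \forall y \near chart i p, cod i y -> dom j (ichart i y) := ci _ nj.
have nC : nbhs (chart i p) (cod i) by apply: open_nbhs_nbhs; split => //; exact: open_cod.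
rewrite /interior /=; near=> y.
have [q iq qy] : cod i y by near: y.
have K : cod i y -> dom j (ichart i y) by near: y.
exists q => //; split => //.
by rewrite -(chartK iq) qy; apply: K; exists q.
Unshelve. all: by end_near. Qed.

Lemma tau_derivable i j p v c : dom i p -> dom j p ->
  derivable (fun y => tau i j y 0 c) (chart i p) v.
Proof.
move=> ip jp; have xO : (chart i @` (dom i `&` dom j)) (chart i p) by exists p.
have [_ /(_ v)[/(_ _ xO) H _]] := @transition_smooth R M A i j 1%N.
rewrite /derivable_within (diffquot_within_open _ _ (@open_overlap i j)) // in H.
have K : derivable (tau i j) (chart i p) v by [].
by move/derivable_mxP : K; apply.
Qed.

Context (T : \bar R).

Definition lifts i (u : R -> M -> R) (U :
  smfun (@open_spacetime R T (cod i) (@open_cod i))) :=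
  forall t x, spacetime T (cod i) (t, x) -> U (t, x) = u t (ichart i x).

Lemma lifts_chart i u U t p : @lifts i u U -> opentime T t -> dom i p
  -> U (t, chart i p) = u t p.
Proof. by move=> H ot ip; rewrite H ?chartK //; split => //; exact: cod_chart. Qed.

Lemma lifts_dt i u U t p : @lifts i u U -> opentime T t -> dom i p ->
  dt U (t, chart i p) = ddt (fun s => u s p) t.
Proof.
move=> H ot ip; apply/esym; apply: ddtE; first by split => //; exact: cod_chart.
by move=> s os; rewrite (lifts_chart H).
Qed.

Lemma lifts_dx i j u Ui Uj t p a : @lifts i u Ui -> @lifts j u Uj ->
  opentime T t -> dom i p -> dom j p ->
  dx a Ui (t, chart i p) = \sum_c jac i j (chart i p) a c * dx c Uj (t, chart j p).
Proof.
move=> Hi Hj ot ip jp; rewrite big_ord2.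
set x := chart i p; set y := chart j p.
pose e := delta_mx 0 a : E.
(* [al] is the displacement, seen in chart [j], along the coordinate line of chart [i] in direction
   [a]; [is_derive0_chain] is applied to [Uj] along this curve. *)
pose al c (h : R) := tau i j (x + h *: e) 0 c - y 0 c.
have Dz : spacetime T (cod j) (t, y) by split => //; exact: cod_chart.
have Dx : spacetime T (cod i) (t, x) by split => //; exact: cod_chart.
have al0 c : al c 0 = 0 by rewrite /al scale0r addr0 tau_chart // subrr.
have dal c : is_derive (0 : R) (1 : R) (al c) (jac i j x a c).
  have d : is_derive (0 : R) (1 : R) (fun h : R => tau i j (x + h *: e) 0 c)
    (jac i j x a c).
    have := @is_derive_line R E (fun y => tau i j y 0 c) x e 0; rewrite scale0r addr0;
      apply.
    exact: tau_derivable.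
  have := is_deriveB d (is_derive_cst (y 0 c) (0 : R) (1 : R)); rewrite subr0; exact.
have der v z : spacetime T (cod j) z -> derivable Uj z v by exact: smfun_derivable.
have con v : {for (t, y), continuous ('D_v Uj)} by exact: (Cn_cont (sd_Cn v Uj 0) Dz).
have := @is_derive0_chain R (R * E)%type (spacetime T (cod j)) Uj (t, y) (0,
  delta_mx 0 0) (0, delta_mx 0 1)
  (al 0) (al 1) (jac i j x a 0) (jac i j x a 1)
    (@open_spacetime R T (cod j) (@open_cod j)) Dz (der _) (con _) (der _) (con _)
      (al0 0) (al0 1) (dal 0) (dal 1).
rewrite -!(sdE _ _ Dz) -/(dx 0 Uj) -/(dx 1 Uj) => -[_ <-].
have L : is_derive (0 : R) (1 : R) (fun h : R => Ui ((t, x) + h *: (0 : R, e)))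
  (dx a Ui (t, x)).
  rewrite /dx (sdE _ _ Dx).
  have := @is_derive_line R (R * E)%type Ui (t, x) (0, e) 0; rewrite scale0r addr0; apply.
  exact: smfun_derivable.
have [_ <-] := L.
apply: near_eq_derive.
have xO : nbhs x (chart i @` (dom i `&` dom j)).
  by apply: open_nbhs_nbhs; split; [exact: (@open_overlap i j) | exists p].
have N : \forall h \near (0 : R), (chart i @` (dom i `&` dom j)) (x + h *: e).
  have c : {for (0 : R), continuous (fun h : R => x + h *: e)}.
    apply: continuousD; first exact: cst_continuous.
    by move=> ?; apply: cvgZr_tmp; exact: cvg_id.
  by apply: c; rewrite /= scale0r addr0.
apply: filterS N => h [q [iq jq] qx].
have e1 : (t, x) + h *: (0 : R, e) = (t, x + h *: e).
  by rewrite -[RHS](congr1 (fun r => (r, _)) (_ : t + h *: (0 : R) = t)) // scaler0 addr0.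
have e2 : (t, y) + al 0 h *: (0 : R, delta_mx 0 0 : E) + al 1 h *:
  (0 : R, delta_mx 0 1 : E) = (t, chart j q).
  rewrite -[RHS](congr1 (fun r => (r, _)) (_ : t + al 0 h *: (0 : R) + al 1 h *: (0 : R)
    = t)); last first.
    by rewrite !scaler0 !addr0.
  congr (_, _); apply/rowP => c; rewrite !mxE !eqxx /= /al -qx tau_chart //.
  by elim/ord2_ind: c => /=; rewrite ?mulr1 ?mulr0 ?addr0 addrC subrK.
by rewrite e1 e2 -qx (lifts_chart Hi) // (lifts_chart Hj).
Qed.
End Surface.

(** The quotient is the squared length of a covector, by the cofactor formula for the inverse
    metric. Under [J] numerator and denominator both gain the square of det J, which is nonzero
    because the left determinant is; [J] is never inverted. *)
Lemma norm_pullback (R : fieldType) (J p q : 'I_2 -> 'I_2 -> R) (v w : 'I_2 -> R) :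
  (forall a b, p a b = \sum_c \sum_d J a c * J b d * q c d) ->
  (forall a, v a = \sum_c J a c * w c) -> q 1 0 = q 0 1 ->
  p 0 0 * p 1 1 - p 0 1 * p 0 1 != 0 ->
  (p 1 1 * v 0 ^+ 2 - 2 * p 0 1 * v 0 * v 1 + p 0 0 * v 1 ^+ 2) /
    (p 0 0 * p 1 1 - p 0 1 * p 0 1)
  = (q 1 1 * w 0 ^+ 2 - 2 * q 0 1 * w 0 * w 1 + q 0 0 * w 1 ^+ 2) /
    (q 0 0 * q 1 1 - q 0 1 * q 0 1).
Proof.
move=> pE vE q10.
pose de := J 0 0 * J 1 1 - J 0 1 * J 1 0.
have dp : p 0 0 * p 1 1 - p 0 1 * p 0 1 = de ^+ 2 * (q 0 0 * q 1 1 - q 0 1 * q 0 1).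
  by rewrite !pE !big_ord2 q10 /de; ring.
have np : p 1 1 * v 0 ^+ 2 - 2 * p 0 1 * v 0 * v 1 + p 0 0 * v 1 ^+ 2
   = de ^+ 2 * (q 1 1 * w 0 ^+ 2 - 2 * q 0 1 * w 0 * w 1 + q 0 0 * w 1 ^+ 2).
  by rewrite !pE !vE !big_ord2 q10 /de; ring.
rewrite dp np mulf_eq0 negb_or => /andP[d0 q0].
by rewrite invfM mulrACA divff // mul1r.
Qed.

(** * The Ricci flow in charts, and independence of the chart *)

Section Flow.
Context {R : realType} {M : topologicalType} (A : surface_atlas R M) (T : \bar R).
Context (g : R -> components A) (flow : ricci_flow T g).
Local Notation E := 'rV[R]_2.
Local Notation Z := (R * E)%type.
Implicit Types (i j : idx A) (p q : M).

Lemma opentime_timespan t : opentime T t -> timespan T t.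
Proof. by case=> /ltW. Qed.

Lemma flow_smooth i a b n :
  Cn n (spacetime T (cod i)) (fun z : Z => g z.1 i z.2 a b).
Proof.
have [_ sm _] := flow; apply: Ck_Cn (sm i a b n).
  by apply: open_spacetime; exact: open_cod.
by move=> [t x] [/opentime_timespan].
Qed.

Lemma flow_sym i t x : opentime T t -> cod i x -> (g t i x)^T = g t i x.
Proof.
have [m _ _] := flow.
by move=> /opentime_timespan /m[sy _ _ _] cx; exact: sy.
Qed.

Lemma flow_pos i t x : opentime T t -> cod i x -> forall v : E, v != 0 ->
  0 < (v *m g t i x *m v^T) 0 0.
Proof.
have [m _ _] := flow.
by move=> /opentime_timespan /m[_ po _ _] cx; exact: po.
Qed.

Definition chartfun i := smfun (@open_spacetime R T (cod i) (@open_cod R M A i)).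
Definition chart_metric i : 'I_2 -> 'I_2 -> chartfun i
  := @gS R T (cod i) (@open_cod R M A i) (fun t => g t i) (@flow_smooth i).
Definition chart_dinv i : chartfun i
  := @dinvS R T (cod i) (@open_cod R M A i) (fun t => g t i) (@flow_smooth i)
    (@flow_sym i) (@flow_pos i).
Local Notation dx := (@dx R T _ (@open_cod R M A _)).
Local Notation dt := (@dt R T _ (@open_cod R M A _)).
Local Notation half := (@shalf R T _ (@open_cod R M A _)).
Definition chart_Ric i : 'I_2 -> 'I_2 -> chartfun i
  := @Ric (chartfun i) dx half (chart_metric i) (chart_dinv i).
Definition chart_Scal i : chartfun i
  := @Scal (chartfun i) dx half (chart_metric i) (chart_dinv i).
Definition chart_Lap i : chartfun i -> chartfun i
  := @Lap (chartfun i) dx half (chart_metric i) (chart_dinv i).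
Definition chart_ip i : chartfun i -> chartfun i -> chartfun i
  := @ip (chartfun i) dx (chart_metric i) (chart_dinv i).

Lemma chart_metric10 i : chart_metric i 1 0 = chart_metric i 0 1.
Proof. exact: (gS10 _ _ (@flow_sym i)). Qed.

Lemma chart_dinv_det i : chart_dinv i
  * (chart_metric i 0 0 * chart_metric i 1 1 - chart_metric i 0 1 * chart_metric i 0 1)
    = 1.
Proof. exact: dinvS_det. Qed.

Lemma dxD i k (u v : chartfun i) : dx k (u + v) = dx k u + dx k v.
Proof. exact: sdD. Qed.
Lemma dxM i k (u v : chartfun i) : dx k (u * v) = dx k u * v + u * dx k v.
Proof. exact: sdM. Qed.
Lemma dtD i (u v : chartfun i) : dt (u + v) = dt u + dt v.
Proof. exact: sdD. Qed.
Lemma dtM i (u v : chartfun i) : dt (u * v) = dt u * v + u * dt v.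
Proof. exact: sdM. Qed.
Lemma dxC i k l (u : chartfun i) : dx k (dx l u) = dx l (dx k u).
Proof. exact: sdC. Qed.
Lemma dtC i k (u : chartfun i) : dt (dx k u) = dx k (dt u).
Proof. exact: sdC. Qed.

Lemma chart_in i p t : opentime T t -> dom i p -> spacetime T (cod i) (t, chart i p).
Proof. by move=> ot ip; split => //; exact: cod_chart. Qed.

Lemma chart_flow i a b : dt (chart_metric i a b) = - (1 + 1) * chart_Ric i a b.
Proof.
apply: smfunP => -[t x] Dz; have [ot cx] := Dz.
have [_ _ /(_ t (opentime_timespan ot) i x cx a b)] := flow.
rewrite (ddtE (U := chart_metric i a b) Dz); last first.
  by move=> s os; rewrite /chart_metric gSE.
move=> ->; rewrite (ricciE (@open_cod R M A i) (@flow_smooth i) (@flow_sym i)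
  (@flow_pos i) _ _ Dz).
by rewrite smfunME smfunNE smfunDE smfun1E.
Qed.

Lemma dt_chart_metric i a b : dt (chart_metric i a b)
  = - (chart_Scal i * chart_metric i a b).
Proof.
exact: (dt_metric (@shalf2 R T _ (@open_cod R M A i)) (@dxD i) (@dxM i) (@dxC i)
  (chart_metric10 i) (chart_dinv_det i) (@chart_flow i)).
Qed.

Lemma chart_laplacianE i t x (u : E -> R) (U : chartfun i) : spacetime T (cod i) (t, x) ->
  (forall y, cod i y -> u y = U (t, y)) -> laplacian (g t i) u x = chart_Lap U (t, x).
Proof. exact: (@laplacianE R T _ (@open_cod R M A i) (fun t => g t i)). Qed.

Lemma chart_scalar_curvatureE i t x : spacetime T (cod i) (t, x) ->
  scalar_curvature (g t i) x = chart_Scal i (t, x).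
Proof. exact: (@scalar_curvatureE R T _ (@open_cod R M A i) (fun t => g t i)). Qed.

Lemma chart_metric_norm_gradientE i t x (u : E -> R) (U : chartfun i) :
  spacetime T (cod i) (t, x) -> (forall y, cod i y -> u y = U (t, y)) ->
  metric_norm (g t i) x (gradient (g t i) u x) ^+ 2 = chart_ip U U (t, x).
Proof. exact: (@metric_norm_gradientE R T _ (@open_cod R M A i) (fun t => g t i)). Qed.

Lemma metric_change i j p t a b : opentime T t -> dom i p -> dom j p ->
  g t i (chart i p) a b =
  \sum_c \sum_d jac i j (chart i p) a c * jac i j (chart i p) b d * g t j (chart j p) c d.
Proof.
move=> ot ip jp; have [m _ _] := flow.
have [_ _ ch _] := m t (opentime_timespan ot).
rewrite (ch i j (chart i p)); last by exists p.
by rewrite chartK.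
Qed.

(** The Jacobian does not depend on time, so the time derivative of the transformation law of the
    [0 0] component is the same law with the factor [- Scal]; the positive component [0 0] is then
    cancelled. *)
Lemma chart_Scal_change i j p t : opentime T t -> dom i p -> dom j p ->
  chart_Scal i (t, chart i p) = chart_Scal j (t, chart j p).
Proof.
move=> ot ip jp; have Di := chart_in ot ip; have Dj := chart_in ot jp.
pose J a c := jac i j (chart i p) a c.
have di : is_derive t (1 : R) (fun s => g s i (chart i p) 0 0)
  (- (chart_Scal i (t, chart i p) * g t i (chart i p) 0 0)).
  have := @is_derive_dt R T (cod i) _ (chart_metric i 0 0) t _ (fun s =>
    g s i (chart i p) 0 0) Di.
  rewrite dt_chart_metric smfunNE smfunME gSE //; apply => s os; rewrite gSE //;
    exact: chart_in.
have dj c d : is_derive t (1 : R) (fun s => g s j (chart j p) c d)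
  (- (chart_Scal j (t, chart j p) * g t j (chart j p) c d)).
  have := @is_derive_dt R T (cod j) _ (chart_metric j c d) t _ (fun s =>
    g s j (chart j p) c d) Dj.
  rewrite dt_chart_metric smfunNE smfunME gSE //; apply => s os; rewrite gSE //;
    exact: chart_in.
have dj' c d := is_deriveZ (J 0 c * J 0 d) (dj c d).
have sum := is_deriveD (is_deriveD (dj' 0 0) (dj' 0 1)) (is_deriveD (dj' 1 0) (dj' 1 1)).
have N : \forall s \near t, opentime T s.
  by apply: open_nbhs_nbhs; split => //; exact: open_opentime.
have [_ e1] := di; have [_ e2] := sum.
have e3 : g t i (chart i p) 0 0 * chart_Scal i (t, chart i p)
  = g t i (chart i p) 0 0 * chart_Scal j (t, chart j p).
  apply: oppr_inj; rewrite mulrC -e1.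
  rewrite (metric_change 0 0 ot ip jp) !big_ord2.
  transitivity ('D_1 (J 0 0 * J 0 0 *: (fun s => g s j (chart j p) 0 0) +
       J 0 0 * J 0 1 *: (fun s => g s j (chart j p) 0 1) +
       (J 0 1 * J 0 0 *: (fun s => g s j (chart j p) 1 0) +
        J 0 1 * J 0 1 *: (fun s => g s j (chart j p) 1 1))) t).
    apply: near_eq_derive; apply: filterS N => s os.
    by rewrite (metric_change 0 0 os ip jp) !big_ord2.
  rewrite e2 /J ![_ *: _]mulrC.
  move: (chart_Scal j _) (g t j (chart j p)) => r m; ring.
by apply: mulfI e3; rewrite gt_eqF //; exact: (G00_gt0 (@flow_sym i) (@flow_pos i) Di).
Qed.

Local Notation lifts := (@lifts R M A T).

Lemma chart_gi_gt0 i z : spacetime T (cod i) z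
  -> 0 < gi (chart_metric i) (chart_dinv i) 0 0 z /\
  0 < gi (chart_metric i) (chart_dinv i) 0 0 z
    * gi (chart_metric i) (chart_dinv i) 1 1 z
      - gi (chart_metric i) (chart_dinv i) 0 1 z
        * gi (chart_metric i) (chart_dinv i) 0 1 z.
Proof. by move=> Dz; exact: giS_pos. Qed.

Lemma chart_ip_val i t x (U : chartfun i) : spacetime T (cod i) (t, x) ->
  chart_ip U U (t, x) = (g t i x 1 1 * dx 0 U (t, x) ^+ 2
    - 2 * g t i x 0 1 * dx 0 U (t, x) * dx 1 U (t, x)
    + g t i x 0 0 * dx 1 U (t, x) ^+ 2)
    / (g t i x 0 0 * g t i x 1 1 - g t i x 0 1 * g t i x 0 1).
Proof.
move=> Dz.
have [e00 e01 _ e11] := @giS_val R T _ (@open_cod R M A i) _ (@flow_smooth i)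
  (@flow_sym i) (@flow_pos i) _ Dz.
rewrite /chart_ip (@ev_ip _ _ _ _ _ (fun f : chartfun i => f (t, x)) (fun u v =>
  smfunDE u v _) (fun u v => smfunME u v _)).
rewrite /chart_metric /chart_dinv e00 e01 e11 /detG /=.
by move: (g t i x) (dx 0 U _) (dx 1 U _) => m d0 d1; rewrite mulrC; ring.
Qed.

Lemma chart_ip_change i j u (Ui : chartfun i) (Uj : chartfun j) p t : lifts u Ui
  -> lifts u Uj ->
  opentime T t -> dom i p -> dom j p ->
  chart_ip Ui Ui (t, chart i p) = chart_ip Uj Uj (t, chart j p).
Proof.
move=> Hi Hj ot ip jp; have Di := chart_in ot ip; have Dj := chart_in ot jp.
rewrite !chart_ip_val //.
apply: (@norm_pullback R (jac i j (chart i p)) (g t i (chart i p)) (g t j (chart j p))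
  (fun a => dx a Ui (t, chart i p)) (fun a => dx a Uj (t, chart j p))).
- by move=> a b; exact: metric_change.
- by move=> a; exact: (lifts_dx _ Hi Hj).
- exact: (G10 (@flow_sym j) Dj).
- by apply: lt0r_neq0; exact: (detG_gt0 (@flow_sym i) (@flow_pos i) Di).
Qed.

Lemma harnack_change (k : R) i j u (Ui : chartfun i) (Uj : chartfun j) p t : lifts u Ui
  -> lifts u Uj ->
  dt Ui = chart_Lap Ui + chart_ip Ui Ui - sconst _ k * Ui + chart_Scal i ->
  dt Uj = chart_Lap Uj + chart_ip Uj Uj - sconst _ k * Uj + chart_Scal j ->
  opentime T t -> dom i p -> dom j p ->
  (chart_Lap Ui + chart_Scal i) (t, chart i p)
    = (chart_Lap Uj + chart_Scal j) (t, chart j p).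
Proof.
move=> Hi Hj ei ej ot ip jp; have Di := chart_in ot ip; have Dj := chart_in ot jp.
have solve l (U : chartfun l) z : spacetime T (cod l) z ->
    dt U = chart_Lap U + chart_ip U U - sconst _ k * U + chart_Scal l ->
    (chart_Lap U + chart_Scal l) z = dt U z - chart_ip U U z + k * U z.
  move=> Dz e; rewrite e !smfunDE smfunNE smfunME sconstE //.
  by move: (chart_Lap U z) (chart_ip U U z) (chart_Scal l z) (U z) => *; ring.
rewrite (solve i _ _ Di ei) (solve j _ _ Dj ej) (chart_ip_change Hi Hj) //.
by rewrite (lifts_dt Hi) // (lifts_dt Hj) // (lifts_chart Hi) // (lifts_chart Hj).
Qed.

Lemma chart_cvg i p : dom i p -> {for p, continuous (chart i)}.
Proof.
move=> ip; have := (@subspace_continuousP M (dom i) E (chart i)).1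
  (@chart_continuous R M A i) p ip.
by rewrite within_interior //; apply: open_nbhs_nbhs; split => //;
  exact: (@dom_open R M A i).
Qed.

(** One principle serves both ln R and ln f; its hypothesis at a critical point is what
    [hamilton_reaction] and [heat_reaction] provide. *)
Lemma max_principle (Q : forall i, chartfun i) (s : R) : compact [set: M] -> 0 < s ->
  (forall i j p t, opentime T t -> dom i p -> dom j p ->
    Q i (t, chart i p) = Q j (t, chart j p)) ->
  (forall i t x, spacetime T (cod i) (t, x) -> s < t ->
    dx 0 (Q i) (t, x) = 0 -> dx 1 (Q i) (t, x) = 0 -> 0 <= chart_Lap (Q i) (t, x) ->
    (t - s) * Q i (t, x) + 1 < 0 -> 0 < Q i (t, x) + (t - s) * dt (Q i) (t, x)) ->
  forall i p t, opentime T t -> s <= t -> dom i p ->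
  0 <= (t - s) * Q i (t, chart i p) + 1.
Proof.
move=> cM s0 Qch react i p t ot st ip.
(* A chart is chosen at every point to make [Q] a function on the whole surface; by [qE] any other
   chart gives the same value. *)
pose ic p' := sval (cid (@dom_cover R M A p')).
have icP p' : dom (ic p') p' by exact: (svalP (cid (@dom_cover R M A p'))).
pose q r p' := Q (ic p') (r, chart (ic p') p').
have qE j p' r : opentime T r -> dom j p' -> q r p' = Q j (r, chart j p').
  by move=> or jp; rewrite /q (Qch (ic p') j).
pose F (z : R * M) := (z.1 - s) * q z.1 z.2 + 1.
have oT r : s <= r <= t -> opentime T r.
  move=> /andP[sr rt]; split; first exact: lt_le_trans sr.
  by have [_] := ot; apply: le_lt_trans; rewrite lee_fin.
pose K := `[s, t]%classic `*` [set: M].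
have cK : compact K by apply: compact_setX => //; exact: segment_compact.
have cF : {within K, continuous F}.
  apply: continuous_in_subspaceT => -[r p'] /set_mem[/= rK _].
  have or : opentime T r by apply: oT; move: rK; rewrite in_itv.
  (* The choice [ic] need not vary continuously, so continuity is checked in one chart [j] valid at
     all nearby points. *)
  have [j jp] := @dom_cover R M A p'.
  have cq : {for (r, p'), continuous (fun z : R * M =>
    (z.1 - s) * Q j (z.1, chart j z.2) + 1)}.
    apply: continuousD; last exact: cst_continuous.
    apply: continuousM.
      by apply: continuousB; [exact: cvg_fst | exact: cst_continuous].
    have c1 : {for (r, p'), continuous (fun z : R * M => (z.1, chart j z.2))}.
      have cs : z.2 @[z --> (r, p')] --> p' by exact: cvg_snd.
      have cf : z.1 @[z --> (r, p')] --> r by exact: cvg_fst.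
      have cp : chart j z.2 @[z --> (r, p')] --> chart j p'.
        by apply: (@continuous_comp _ _ _ snd (chart j) (r, p'));
          [exact: cs | exact: chart_cvg].
      exact: cvg_pair cf cp.
    have c2 : {for (r, chart j p'), continuous (Q j)}.
      by exact: (Cn_cont (smfun_Cn (Q j) 0) (chart_in or jp)).
    exact: (continuous_comp c1 c2).
  have N : \forall z \near (r, p'), opentime T z.1 /\ dom j z.2.
    exists (opentime T, dom j) => //=; split; apply: open_nbhs_nbhs; split => //.
      exact: open_opentime.
    exact: (@dom_open R M A j).
  have E1 : \forall z \near (r, p'), (z.1 - s) * Q j (z.1, chart j z.2) + 1 = F z.
    by apply: filterS N => -[r' p''] /= [or' jp'']; rewrite /F (qE j).
  rewrite /continuous_at; have -> : F (r, p') = (r - s) * Q j (r, chart j p') + 1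
    by rewrite /F (qE j).
  apply: cvg_trans cq; exact: near_eq_cvg.
have K0 : K !=set0 by exists (t, p); split => //=; rewrite in_itv /= st lexx.
have [[r p'] /set_mem[/= rK _] Fmin] := compact_EVT_min K0 cK cF.
rewrite leNgt; apply/negP => Fneg.
have {}rK : s <= r <= t by move: rK; rewrite in_itv.
have or := oT r rK.
have inK r' q' : s <= r' <= t -> F (r, p') <= F (r', q').
  by move=> h; apply: Fmin; apply: mem_set; split => //=; rewrite in_itv.
have Frp : F (r, p') < 0.
  apply: le_lt_trans Fneg; have := inK t p; rewrite {2}/F /= (qE i) //; apply.
  by rewrite st lexx.
(* At time [s] the function equals 1, so a negative minimum occurs later and has earlier times to
   compare with. *)
have sr : s < r.
  have /andP[sr _] := rK; rewrite lt_neqAle sr andbT; apply/eqP => sr'.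
  by move: Frp; rewrite /F /= -sr' subrr mul0r add0r ltr10.
have [j jp] := @dom_cover R M A p'.
have Dz := chart_in or jp.
have FE r' : opentime T r' -> F (r', p') = (r' - s) * Q j (r', chart j p') + 1.
  by move=> or'; rewrite /F (qE j).
have [d0 d1 L0] : [/\ dx 0 (Q j) (r, chart j p') = 0, dx 1 (Q j) (r, chart j p') = 0 & 0
  <= chart_Lap (Q j) (r, chart j p')].
  (* At the fixed time [r] the factor [r - s] is positive, so a minimum of [F] in space is one of
     [Q]. *)
  apply: lap_min => // _ [q' jq <-].
  have := inK r q' rK; rewrite /F /= !(qE j) // lerD2r ler_pM2l // subr_gt0 //.
have neg : (r - s) * Q j (r, chart j p') + 1 < 0 by rewrite -FE.
have := react j r _ Dz sr d0 d1 L0 neg.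
apply/negP; rewrite -leNgt.
pose phi r' := (r' - s) * Q j (r', chart j p') + 1.
have dphi : is_derive r (1 : R) phi
  (Q j (r, chart j p') + (r - s) * dt (Q j) (r, chart j p')).
  have dQ := @is_derive_dt R T (cod j) _ (Q j) r _ (fun r' => Q j (r', chart j p')) Dz
    (fun _ _ => erefl).
  have dl := is_deriveB (is_derive_id r (1 : R)) (is_derive_cst s r (1 : R)).
  have H := is_deriveD (is_deriveM dl dQ) (is_derive_cst (1 : R) r (1 : R)).
  apply: (is_derive_eq H); rewrite !fctE subr0 addr0 addrC [_%:A]mulr1 [_ *: _]mulrC.
  by move: (dt (Q j) _) (Q j _) => a b; ring.
apply: (left_derive_le0 sr dphi) => r' /andP[sr' r'r].
have or' : s <= r' <= t by rewrite sr'; have /andP[_] := rK; exact: le_trans.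
by rewrite /phi -!FE; [exact: inK | exact: oT..].
Qed.

Lemma smfun_log i (f : chartfun i) : (forall z, spacetime T (cod i) z -> 0 < f z) ->
  exists l : chartfun i, [/\ forall z, spacetime T (cod i) z -> l z = ln (f z),
    forall c, dx c f = f * dx c l & dt f = f * dt l].
Proof.
move=> f0; pose oD := @open_spacetime R T (cod i) (@open_cod R M A i).
pose l : chartfun i := smk oD (fun n => Cn_ln oD f0 (smfun_Cn f n)).
have lE z : spacetime T (cod i) z -> l z = ln (f z) by exact: smkE.
have dl v : sd v f = f * sd v l.
  apply: smfunP => z Dz; rewrite smfunME !(sdE _ _ Dz).
  have -> : 'D_v l z = 'D_v (fun y => ln (f y)) z.
    by apply: near_eq_derive; apply: (near_open oD Dz) => y; exact: lE.
  have [_ ->] := is_derive_ln (f0 z Dz) (@smfun_derivable R _ _ _ v f z Dz).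
  by rewrite mulrA divff ?mul1r // gt_eqF // f0.
by exists l; split => // [c|]; exact: dl.
Qed.

(** Cancellation is pointwise, [f] being nonzero throughout the domain; it serves to divide an
    evolution equation by R or by f. *)
Lemma smfun_mulI i (f u v : chartfun i) : (forall z, spacetime T (cod i) z -> 0 < f z) ->
  f * u = f * v -> u = v.
Proof.
move=> f0 e; apply: smfunP => z Dz; have := congr1 (fun h : chartfun i => h z) e.
by rewrite /= !smfunME; apply: mulfI; rewrite gt_eqF // f0.
Qed.

Lemma chart_Lap_log i (f u : chartfun i) : (forall c, dx c f = f * dx c u) ->
  chart_Lap f = f * (chart_Lap u + chart_ip u u).
Proof. exact: (Lap_log half (@dxM i)). Qed.

(** * Hamilton's estimate and the estimate for the heat equation *)

Context (closedM : compact [set: M]).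
Context (Scal_gt0 : forall i z, spacetime T (cod i) z -> 0 < chart_Scal i z).

Lemma dt_chart_Scal i : dt (chart_Scal i)
  = chart_Lap (chart_Scal i) + chart_Scal i * chart_Scal i.
Proof.
exact: (dt_Scal (@shalf2 R T _ (@open_cod R M A i)) (@dxD i) (@dxM i) (@dtD i) (@dtM i)
  (@dxC i) (@dtC i) (chart_metric10 i) (chart_dinv_det i) (@chart_flow i)).
Qed.

(** [L] is ln R in each chart; only its gradient relation to [Scal] and the bound are exported,
    which is all that [heat_reaction] asks of it. *)
Lemma hamilton_harnack : exists L : forall i, chartfun i,
  [/\ forall i c, dx c (chart_Scal i) = chart_Scal i * dx c (L i) &
    forall s t i p, 0 < s -> s <= t -> opentime T t -> dom i p ->
      0 <= (t - s) * (chart_Lap (L i) + chart_Scal i) (t, chart i p) + 1].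
Proof.
have [L LP] : exists L : forall i, chartfun i, forall i,
    [/\ forall z, spacetime T (cod i) z -> L i z = ln (chart_Scal i z),
      forall c, dx c (chart_Scal i) = chart_Scal i * dx c (L i) & dt (chart_Scal i)
        = chart_Scal i * dt (L i)].
  exists (fun i => sval (cid (smfun_log (@Scal_gt0 i)))) => i.
  exact: (svalP (cid (smfun_log (@Scal_gt0 i)))).
exists L; split; first by move=> i; have [_ H _] := LP i.
have Lt i : dt (L i) = chart_Lap (L i) + chart_ip (L i) (L i) + chart_Scal i.
  have [_ Lx Lt] := LP i; apply: (smfun_mulI (@Scal_gt0 i)).
  by rewrite -Lt dt_chart_Scal (chart_Lap_log Lx) [RHS]mulrDr.
have Lt' i : dt (L i) = chart_Lap (L i) + chart_ip (L i) (L i) - sconst _ 0 * (L i)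
  + chart_Scal i.
  have -> : sconst (@open_spacetime R T (cod i) (@open_cod R M A i)) 0 = 0 by apply:
    smfunP => z Dz; rewrite sconstE // smfun0E.
  by rewrite mul0r subr0.
pose ic p' := sval (cid (@dom_cover R M A p')).
have icP p' : dom (ic p') p' by exact: (svalP (cid (@dom_cover R M A p'))).
(* [r] is ln R on the surface, read in a chosen chart at each point; [chart_Scal_change] makes the
   choice immaterial. *)
pose r t p := ln (chart_Scal (ic p) (t, chart (ic p) p)).
have Ll i : lifts r (L i).
  move=> t x Dz; have [/= ot [p ip px]] := Dz.
  have [LE _ _] := LP i; rewrite LE // -px chartK // /r.
  by rewrite (chart_Scal_change ot ip (icP p)).
move=> s t i p s0 st ot ip.
apply: (max_principle (Q := fun i => chart_Lap (L i) + chart_Scal i)) => //.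
  by move=> j k q r' or jq kq; apply: (harnack_change (k := 0) (Ll j) (Ll k)).
move=> j r' x Dz sr q0 q1 Lq neg.
have [a0 d0] := chart_gi_gt0 Dz.
have [_ Lx _] := LP j.
have sr' : 0 < r' - s by rewrite subr_gt0.
exact: (@hamilton_reaction (chartfun j) dx dt half (@shalf2 R T _ (@open_cod R M A j))
  (@dxD j) (@dxM j) (@dtD j) (@dtM j) (@dxC j) (@dtC j)
  (chart_metric j) (chart_dinv j) (chart_metric10 j) (chart_dinv_det j)
    (@chart_flow j) R (fun f : chartfun j => f (r', x)) (fun u v => smfunDE u v _)
      (fun u v => smfunME u v _) (smfun1E _ Dz) a0 d0 (L j) _ sr' (Scal_gt0 Dz) Lx
        (Lt j) q0 q1 Lq neg).
Qed.

Lemma heat_harnack (u : R -> M -> R) (U : forall i, chartfun i) :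
  (forall i, lifts u (U i)) ->
  (forall i, dt (U i) = chart_Lap (U i) + chart_ip (U i) (U i) - U i + chart_Scal i) ->
  forall t i p, opentime T t -> dom i p ->
    0 <= (chart_Lap (U i) + chart_Scal i) (t, chart i p) + t^-1.
Proof.
move=> Ul Ut t i p ot ip; have [L [Lx LH]] := hamilton_harnack.
have Ut' j : dt (U j) = chart_Lap (U j) + chart_ip (U j) (U j) - sconst _ 1 * (U j)
  + chart_Scal j.
  have -> : sconst (@open_spacetime R T (cod j) (@open_cod R M A j)) 1 = 1 by apply:
    smfunP => z Dz; rewrite sconstE // smfun1E.
  by rewrite mul1r.
have H s : 0 < s -> s <= t -> 0 <= (t - s)
  * (chart_Lap (U i) + chart_Scal i) (t, chart i p) + 1.
  move=> s0 st; apply: (max_principle (Q := fun i => chart_Lap (U i) + chart_Scal i)) =>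
    //.
    by move=> j k q r' or jq kq; apply: (harnack_change (k := 1) (Ul j) (Ul k)).
  move=> j r' x Dz sr q0 q1 Lq neg.
  have [a0 d0] := chart_gi_gt0 Dz.
  have sr' : 0 < r' - s by rewrite subr_gt0.
  have [/= or [q jq qx]] := Dz.
  (* Hamilton's estimate is used with the same [s], so both quantities carry the factor [r' - s],
     the [tau] of [heat_reaction]. *)
  have HL := LH s r' j q s0 (ltW sr) or jq; rewrite qx in HL.
  exact: (@heat_reaction (chartfun j) dx dt half (@shalf2 R T _ (@open_cod R M A j))
    (@dxD j) (@dxM j) (@dtD j) (@dtM j) (@dxC j) (@dtC j)
    (chart_metric j) (chart_dinv j) (chart_metric10 j) (chart_dinv_det j)
      (@chart_flow j) R (fun f : chartfun j => f (r', x)) (fun u v => smfunDE u v _)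
        (fun u v => smfunME u v _) (smfun1E _ Dz) a0 d0 (L j) (U j) _ sr' (Scal_gt0 Dz)
          (Lx j) HL (Ut j) q0 q1 Lq neg).
have t0 : 0 < t by case: ot.
move: H; generalize ((chart_Lap (U i) + chart_Scal i) (t, chart i p)) => Q H.
rewrite -(pmulr_rge0 _ t0) mulrDr divff ?gt_eqF // leNgt; apply/negP => neg.
have Q0 : Q < 0 by rewrite -(pmulr_rlt0 _ t0); lra.
(* In place of a limit s -> 0 one value suffices: t Q + 1 < 0 forces t + 1/Q > 0, and for half of it
   (t - s) Q + 1 = (t Q + 1) / 2 is still negative. *)
pose s := (t + Q^-1) / 2.
have tQ : 0 < t + Q^-1.
  by rewrite -(nmulr_rlt0 _ Q0) mulrDr divff ?lt_eqF // mulrC.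
have Qi : Q^-1 < 0 by rewrite invr_lt0.
have := H s; rewrite /s => /(_ ltac:(lra) ltac:(lra)).
have -> : (t - (t + Q^-1) / 2) * Q + 1 = (t * Q + 1) / 2 by field; rewrite lt_eqF.
lra.
Qed.
End Flow.

(** * From the chart functions back to the equation and the inequality on the surface *)

Theorem corollary1p3 (R : realType) (M : topologicalType)
  (A : surface_atlas R M) (T : \bar R)
  (g : R -> components A) (f : R -> M -> R)
  (closedM : closed_surface M)
  (T_gt0 : (0 < T)%E)
  (flow : ricci_flow T g)
  (scal_gt0 : forall t, timespan T t -> forall (i : idx A) p, dom i p ->
     0 < scalar_curvature (g t i) (chart i p))
  (f_smooth : smooth_evolution A T f)
  (f_gt0 : forall t, timespan T t -> forall p, 0 < f t p)
  (f_heat : forall t, timespan T t -> forall (i : idx A) p, dom i p ->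
     ddt (fun s => f s p) t =
       laplacian (g t i) (in_chart i (f t)) (chart i p)
       - f t p * ln (f t p)
       + scalar_curvature (g t i) (chart i p) * f t p) :
  forall t : R, 0 < t -> (t%:E < T)%E -> forall (i : idx A) p, dom i p ->
    let x := chart i p in
    let lnf := fun s q => ln (f s q) in
    let harnack :=
      laplacian (g t i) (in_chart i (lnf t)) x
      + scalar_curvature (g t i) x + t^-1 in
    ddt (fun s => lnf s p) t
      - metric_norm (g t i) x (gradient (g t i) (in_chart i (lnf t)) x) ^+ 2
      + lnf t p + t^-1 = harnack
    /\ 0 <= harnack.
Proof.
have sc0 (i : idx A) z : spacetime T (cod i) z -> 0 < chart_Scal flow i z.
  case: z => t x Dz; have [/= ot [p ip px]] := Dz.
  rewrite -(chart_scalar_curvatureE flow Dz) -px.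
  by apply: scal_gt0 => //; exact: opentime_timespan.
have cM : compact [set: M] by case: closedM.
have fC (i : idx A) n : Cn n (spacetime T (cod i)) (fun z : R * 'rV[R]_2 =>
  in_chart i (f z.1) z.2).
  have H : Ck n (timespan T `*` cod i) (fun z : R * 'rV[R]_2 => in_chart i (f z.1) z.2)
    := f_smooth i n.
  apply: Ck_Cn H; first by apply: open_spacetime; exact: open_cod.
  by move=> [t x] [/opentime_timespan].
pose F (i : idx A) : chartfun T i := smk
  (@open_spacetime R T (cod i) (@open_cod R M A i)) (fC i).
have FE (i : idx A) t x : spacetime T (cod i) (t, x) -> F i (t, x) = f t (ichart i x).
  by move=> Dz; exact: (smkE _ _ Dz).
have F0 (i : idx A) z : spacetime T (cod i) z -> 0 < F i z.
  by case: z => t x Dz; rewrite FE //; apply: f_gt0; apply: opentime_timespan; case: Dz.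
have [U UP] : exists U : forall i, chartfun T i, forall i,
    [/\ forall z, spacetime T (cod i) z -> U i z = ln (F i z),
      forall c, dx c (F i) = F i * dx c (U i) & dt (F i) = F i * dt (U i)].
  exists (fun i => sval (cid (smfun_log (F0 i)))) => i.
  exact: (svalP (cid (smfun_log (F0 i)))).
have Ul i : lifts (fun t p => ln (f t p)) (U i).
  by move=> t x Dz; have [-> // _ _] := UP i; rewrite FE.
have Fl i : lifts f (F i) by move=> t x; exact: FE.
have Ft i : dt (F i) = chart_Lap flow (F i) - F i * U i + chart_Scal flow i * F i.
  apply: smfunP => -[t x] Dz; have [/= ot [p ip px]] := Dz; rewrite -px.
  have Dp := chart_in ot ip.
  rewrite (lifts_dt (Fl i) ot ip) (f_heat t (opentime_timespan ot) i p ip).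
  have LE := chart_laplacianE flow Dp.
  rewrite (LE _ (F i)); last by move=> y cy; rewrite (FE i t y) //.
  rewrite (chart_scalar_curvatureE flow Dp).
  rewrite !smfunDE smfunNE !smfunME (lifts_chart (Fl i)) // (lifts_chart (Ul i)) //.
have Ut i : dt (U i) = chart_Lap flow (U i) + chart_ip flow (U i) (U i) - U i
  + chart_Scal flow i.
  (* In terms of U = ln F every term of the heat equation has the factor [F]; cancelling it gives
     the equation for ln f. *)
  have [_ Ux Utt] := UP i; apply: (smfun_mulI (F0 i)).
  rewrite -Utt Ft (chart_Lap_log _ Ux);
    move: (chart_Lap flow (U i)) (chart_ip flow (U i) (U i)) (chart_Scal flow i) (F i)
      (U i) => a b c d e.
  ring.
move=> t t0 tT i p ip x lnf harnack.
have ot : opentime T t by [].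
have Dp := chart_in ot ip.
have lnfE y : cod i y -> in_chart i (lnf t) y = U i (t, y).
  by move=> cy; rewrite (Ul i).
have hE : harnack = (chart_Lap flow (U i) + chart_Scal flow i) (t, chart i p) + t^-1.
  rewrite /harnack (chart_laplacianE flow Dp lnfE).
  rewrite (chart_scalar_curvatureE flow Dp).
  by rewrite smfunDE.
split; last by rewrite hE; exact: (heat_harnack cM sc0 Ul Ut).
(* The equality is the evolution equation [Ut] of ln f, evaluated at the point and rearranged. *)
rewrite (chart_metric_norm_gradientE flow Dp lnfE).
rewrite -(lifts_dt (Ul i) ot ip) Ut hE /lnf -(lifts_chart (Ul i) ot ip).
rewrite !smfunDE smfunNE.
move: (chart_Lap flow (U i) _) (chart_ip flow (U i) (U i) _) (chart_Scal flow i _)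
  (U i _) => a b c d.
ring.
Qed.
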